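(* Let $(F,\mathcal{H},\gamma)$ be a Gaussian Fréchet space and let $f\colon F\to[0,\infty]$ be measurable. Assume that there are nonnegative random variables $g\in L^1(\gamma)$ and $\sigma\in L^2(\gamma)$ (on $F$) such that $$f(x+h)\le g(x)+\sigma(x)|h|_{\mathcal{H}}$$ holds for every $x\in F$ and $h\in\mathcal{H}$. Then $f$ has Gaussian tails.
   Context: A Gaussian Fréchet space is a triple $(F,\mathcal{H},\gamma)$ where $F$ is a separable Fréchet space (a locally convex topological vector space which is separable and completely metrizable), $\gamma$ is a Gaussian measure on the Borel $\sigma$-field of $F$ (every continuous linear functional has a Gaussian, possibly degenerate, law under $\gamma$), and $\mathcal{H}\subseteq F$ is the Cameron–Martin space of $\gamma$, a separable Hilbert space with norm $|\cdot|_{\mathcal{H}}$; explicitly $\mathcal{H}=\{h\in F:|h|_{\mathcal{H}}<\infty\}$, $|h|_{\mathcal{H}}=\sup\{l(h): l\in F^*,\ \mathrm{Var}_\gamma(l)\le1\}$. ''$f$ has Gaussian tails'' means there are constants $K,\eta>0$ with $\gamma\{f>r\}\le Ke^{-\eta r^2}$ for all $r\ge0$. *)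

(* Defs.v *)
From HB Require Import structures.
From mathcomp Require Import all_boot all_order all_algebra.
From mathcomp Require Import all_classical all_reals all_analysis.
From mathcomp Require Import measurable_realfun.

Set Implicit Arguments.
Unset Strict Implicit.
Unset Printing Implicit Defensive.

Import Order.TTheory GRing.Theory Num.Theory.
Import numFieldNormedType.Exports.

Local Open Scope classical_set_scope.
Local Open Scope ring_scope.

Definition separable (T : topologicalType) : Prop :=
  exists2 S : set T, countable S & dense S.

Definition completely_metrizable (R : realType) (T : topologicalType) : Prop :=
  exists d : T -> T -> R,
  [/\ [/\ forall x y, 0 <= d x y,
          forall x y, d x y = 0 <-> x = y,
          forall x y, d x y = d y x &
          forall x y z, d x z <= d x y + d y z],
      forall (x : T) (A : set T),
        nbhs x A <-> exists2 e : R, 0 < e & [set y | d x y < e] `<=` A &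
      forall u : nat -> T,
        (forall e : R, 0 < e -> exists N : nat,
           forall m n : nat, (N <= m)%N -> (N <= n)%N -> d (u m) (u n) < e) ->
        exists l : T, u @ \oo --> l].

(* A tvsType is a locally convex topological vector space.  Its uniform
   structure is only required to induce the topology and need not be
   translation invariant, so completeness is not expressed through it. *)
Definition separable_frechet (R : realType) (F : tvsType R) : Prop :=
  separable F /\ completely_metrizable R F.

(* measurableType requires a point, which tvsType does not provide. *)
Definition pointed_tvs (R : realType) (F : tvsType R) : Type := F.

HB.instance Definition _ (R : realType) (F : tvsType R) :=
  Choice.on (pointed_tvs F).
HB.instance Definition _ (R : realType) (F : tvsType R) :=
  isPointed.Build (pointed_tvs F) (0 : F).

Definition borel (R : realType) (F : tvsType R) :=
  g_sigma_algebraType (@open F : set (set (pointed_tvs F))).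

HB.instance Definition _ (R : realType) (F : tvsType R) :=
  Measurable.on (borel F).

(* normal_prob m 0 is a junk value of the library, hence the separate
   Dirac case; s is the standard deviation. *)
Definition gaussian_law (R : realType) (P : set R -> \bar R) : Prop :=
  exists m s : R, 0 <= s /\
    forall B : set R, measurable B ->
      P B = if s == 0 then \d_m B else normal_prob m s B.

Section gaussian_frechet.
Variables (R : realType) (F : tvsType R).
Implicit Types gamma : probability (borel F) R.

Definition gaussian_measure gamma : Prop :=
  forall l : {linear F -> R^o}, continuous l ->
    gaussian_law (pushforward gamma (l : borel F -> R)).

Definition cm_norm gamma (h : F) : \bar R :=
  ereal_sup [set (l h)%:E | l in [set l : {linear F -> R^o} |
    continuous l /\ (variance gamma (l : borel F -> R) <= 1)%E]].

Definition cameron_martin gamma : set F :=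
  [set h | (cm_norm gamma h < +oo)%E].

Definition gaussian_tails gamma (f : F -> \bar R) : Prop :=
  exists K eta : R, [/\ 0 < K, 0 < eta &
    forall r : R, 0 <= r ->
      (gamma [set x | r%:E < f x] <= (K * expR (- eta * r ^+ 2))%:E)%E].

End gaussian_frechet.

(* Main.v *)
(* The functionals entering cm_norm are continuous linear, so if A and C are compact
   and at Cameron-Martin distance more than r, finitely many functionals l with
   variance at most 1 already satisfy max l(c - a) > r on A x C.  Gram-Schmidt writes
   them, almost surely, through finitely many centered functionals that are jointly
   standard normal, whose images of A and C are Euclidean-separated by a multiple of r.
   Maurey's property (tau): "f(x) g(y) <= exp(|x - y|^2 / 4) implies
   int f . int g <= 1" tensorizes, holds in dimension one by Prekopa-Leindler, and gives
   gamma(A) gamma(C) <= K exp(- eta r^2); inner regularity extends this to measurable A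
   and C.  The growth condition says that, when A = {g <= M, sigma <= M} has positive
   measure, {f > M + M r} is at Cameron-Martin distance more than r from A. *)

Require Import Defs.
From HB Require Import structures.
From mathcomp Require Import all_boot all_order all_algebra.
From mathcomp Require Import all_classical all_reals all_analysis.
From mathcomp Require Import measurable_realfun.
From mathcomp Require Import ring lra.
Import Order.TTheory GRing.Theory Num.Theory.
Import numFieldNormedType.Exports.

Set Implicit Arguments.
Unset Strict Implicit.
Unset Printing Implicit Defensive.

Local Open Scope classical_set_scope.
Local Open Scope ring_scope.

(** * Layer cake formula *)

(** The Cameron-Martin norm is a supremum over a possibly uncountable family of functionals, and the
    enlargement of A by a Cameron-Martin ball is awkward to measure. Bounding a product gamma(A)
    gamma(C) for two separated sets avoids the enlargement, and compactness of A x C leaves finitely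
    many functionals. Gaussianity is given for one functional at a time. Linear combinations are
    again functionals, so the integrals of cos(sum t_i xi_i + b) are known, and the joint law is
    recovered from them in the manner of Cramer-Wold. The argument stays real: pointwise limits of
    trigonometric polynomials produce the indicators of half-lines. Neither the second moment nor
    the characteristic function phi of the standard normal law is evaluated. The former is a
    positive constant kappa that rescales covariances; the latter enters through phi(s) phi(t) =
    phi(sqrt(s^2 + t^2)). The Euclidean images of A and C, taken after removal of a null set, may
    fail to be measurable. Unions of small grid cubes replace them, at a cost in the constants. *)

Section subgraph.
Context d (T : measurableType d) (R : realType) (F : T -> R).
Hypotheses (mF : measurable_fun setT F) (F0 : forall x, 0 <= F x).

Definition subgraph : set (T * R) := [set z | (0 <= z.2) && (z.2 < F z.1)].

Lemma measurable_subgraph : measurable subgraph.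
Proof.
rewrite (_ : subgraph = (setT `&` snd @^-1` `[0%R, +oo[) `&`
  (setT `&` (fun z => z.2 < F z.1) @^-1` [set true])).
  apply: measurableI; first exact: measurable_snd.
  apply: measurable_fun_ltr => //.
  exact: measurableT_comp.
by apply/seteqP; split=> -[x t] /=; rewrite /subgraph/= !in_itv /= ?andbT;
  [move=> /andP[]|move=> [[_ ->] [_ ->]]].
Qed.

Lemma integral_subgraph_xsection x :
  (\int[lebesgue_measure]_t (\1_subgraph (x, t))%:E = (F x)%:E)%E.
Proof.
rewrite (_ : (fun t => (\1_subgraph (x, t))%:E) =
   (fun t => (\1_(`[0%R, F x[%classic) t)%:E)); last first.
  apply/funext => t; rewrite !indicE; congr (nat_of_bool _)%:R%:E.
rewrite integral_indic//= setIT lebesgue_measure_itv/= lte_fin.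
by case: ltP (F0 x) => [_ _|h1 h2]; [rewrite oppr0 adde0|congr EFin; lra].
Qed.

Lemma ysection_subgraph t :
  ysection subgraph t = if 0 <= t then [set x | t < F x] else set0.
Proof.
apply/seteqP; split => x; rewrite /ysection /= inE/= /subgraph /=.
  by case: (0 <= t).
by case: (0 <= t).
Qed.

Lemma measurable_superlevel t : measurable [set x | t < F x].
Proof.
by rewrite -[X in measurable X]setTI; apply: (measurable_fun_ltr (f:=cst t)).
Qed.

End subgraph.

Section layer_cake.
Context d (T : measurableType d) (R : realType).
Variable nu : {sigma_finite_measure set T -> \bar R}.
Local Notation mu := (@lebesgue_measure R).

(** Tonelli for the indicator of [subgraph F]. The subgraph contains levels t >= 0 alone, so the
    outer integral may run over the whole line. *)
Lemma layer_cake (F : T -> R) : measurable_fun setT F -> (forall x, 0 <= F x) ->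
  (\int[nu]_x (F x)%:E = \int[mu]_t nu (ysection (subgraph F) t))%E.
Proof.
move=> mF F0; pose f (z : T * R) : \bar R := (\1_(subgraph F) z)%:E.
have mf : measurable_fun setT f.
  by apply/measurable_EFinP/measurable_indic; exact: measurable_subgraph.
have f0 z : (0 <= f z)%E by rewrite lee_fin.
transitivity (\int[nu]_x \int[mu]_t f (x, t))%E.
  by apply: eq_integral => x _; rewrite integral_subgraph_xsection.
rewrite (@fubini_tonelli _ _ _ _ _ nu mu f)//=; apply: eq_integral => t _.
rewrite -[X in nu X]setIT -integral_indic//; last first.
  by apply: measurable_ysection; exact: measurable_subgraph.
apply: eq_integral => x _; rewrite /f !indicE; congr (nat_of_bool _)%:R%:E.
by apply/idP/idP; rewrite /ysection !inE/= inE.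
Qed.

End layer_cake.

Section density.
Context (R : realType).
Local Notation mu := (@lebesgue_measure R).

(** By the layer cake formula the claim reduces to superlevel sets, where it is the hypothesis on
    [P]; a second use of Tonelli reassembles f under the weight h. *)
Lemma ge0_integral_density (P : probability (measurableTypeR R) R) (h : R -> R)
    (f : R -> R) :
  measurable_fun setT h -> (forall x, 0 <= h x) ->
  (forall A, measurable A -> P A = \int[mu]_(x in A) (h x)%:E)%E ->
  measurable_fun setT f -> (forall x, 0 <= f x) ->
  (\int[P]_x (f x)%:E = \int[mu]_x (f x * h x)%:E)%E.
Proof.
move=> mh h0 PE mf f0; rewrite layer_cake//.
pose g (z : R * R) : \bar R := (\1_(subgraph f) z * h z.1)%:E.
have mg : measurable_fun setT g.
  apply/measurable_EFinP; apply: measurable_funM.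
    by apply: measurable_indic; exact: measurable_subgraph.
  exact: measurableT_comp.
have g0 z : (0 <= g z)%E by rewrite lee_fin mulr_ge0.
transitivity (\int[mu]_x \int[mu]_t g (x, t))%E; last first.
  apply: eq_integral => x _.
  under eq_integral do rewrite /g EFinM [(x, _).1]/=.
  rewrite ge0_integralZr//=; [|apply/measurable_EFinP|by rewrite lee_fin].
    by rewrite EFinM integral_subgraph_xsection.
  apply: (measurableT_comp (f := \1_(subgraph f) : R * R -> R)).
    by apply: measurable_indic; exact: measurable_subgraph.
  exact: pair1_measurable.
rewrite (@fubini_tonelli _ _ _ _ _ mu mu g)//=; apply: eq_integral => t _.
have mS : measurable (ysection (subgraph f) t).
  by apply: measurable_ysection; exact: measurable_subgraph.
rewrite (PE _ mS) integral_mkcond.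
apply: eq_integral => x _; rewrite patchE /g /= indicE -mem_ysection.
by case: ifPn; rewrite ?mul1r ?mul0r.
Qed.

Lemma ge0_integral_normal (m s : R) (f : R -> R) :
  measurable_fun setT f -> (forall x, 0 <= f x) ->
  (\int[normal_prob m s]_x (f x)%:E =
   \int[mu]_x (f x * normal_pdf m s x)%:E)%E.
Proof.
move=> mf f0; apply: ge0_integral_density => //.
- exact: measurable_normal_pdf.
- exact: normal_pdf_ge0.
Qed.

End density.

(** * Property (tau) in dimension one *)

Section prekopa.
Context (R : realType).
Local Notation mu := (@lebesgue_measure R).
Local Notation n := (@normal_pdf R 0 1).

Lemma normal_pdf01E (x : R) : n x = normal_peak 1 * expR (- (x ^+ 2 / 2)).
Proof.
rewrite normal_pdfE ?oner_eq0//= /normal_fun subr0 expr1n; congr (_ * expR _).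
by rewrite mulNr.
Qed.

Lemma normal_pdf01_gt0 (x : R) : 0 < n x.
Proof. by rewrite normal_pdf01E mulr_gt0 ?expR_gt0// normal_peak_gt0// oner_eq0. Qed.

(** The parallelogram identity in the exponent. It is the origin of the 1/4 in property (tau): the
    cost exp((x - y)^2 / 4) turns a product of two densities into the squared density at the
    midpoint, which is the form Prekopa-Leindler takes. *)
Lemma normal_pdf01_midpoint (x y : R) :
  n x * n y * expR ((x - y) ^+ 2 / 4) = n ((x + y) / 2) ^+ 2.
Proof.
rewrite !normal_pdf01E exprMn -expRM_natl.
set p := normal_peak 1; set a := expR _; set b := expR _; set c := expR _.
rewrite (_ : p * a * (p * b) * c = p ^+ 2 * (a * b * c)); last by ring.
by rewrite /a /b /c -!expRD; congr (_ * expR _); field.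
Qed.

Lemma normal_pdf01_le_norm (u v : R) c : c < n u -> `|v| <= `|u| -> c < n v.
Proof.
move=> cu vu; apply: (lt_le_trans cu); rewrite !normal_pdf01E.
rewrite ler_pM2l ?normal_peak_gt0 ?oner_eq0// ler_expR lerN2.
rewrite ler_pM2r// -(real_normK (num_real u)) -(real_normK (num_real v)).
by rewrite lerXn2r ?nnegrE.
Qed.

Lemma normal_pdf01_superlevel_bounded c : 0 < c ->
  exists rho : R, forall u, c < n u -> `|u| < rho.
Proof.
move=> c0; exists (1 + 2 * (normal_peak 1 / c)) => u.
rewrite normal_pdf01E => cu.
have p0 : 0 < normal_peak (1 : R) by rewrite normal_peak_gt0// oner_eq0.
have e1 : expR (- (u ^+ 2 / 2)) * (1 + u ^+ 2 / 2) <= 1.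
  rewrite -[leRHS](expR0) -[X in _ <= expR X](addNr (u ^+ 2 / 2)) expRD.
  by rewrite ler_pM2l ?expR_gt0// expR_ge1Dx.
have q0 : 0 < 1 + u ^+ 2 / 2 by have := sqr_ge0 u; lra.
have : c * (1 + u ^+ 2 / 2) < normal_peak 1.
  apply: (@lt_le_trans _ _ (normal_peak 1 * expR (- (u ^+ 2 / 2)) * (1 + u ^+ 2 / 2))).
    by rewrite ltr_pM2r.
  by rewrite -mulrA ler_piMr// ltW.
rewrite mulrC -ltr_pdivlMr// => h.
rewrite -(real_normK (num_real u)) in h.
have := normr_ge0 u; set a := `|u| in h *; move=> a0.
nra.
Qed.

(* Superlevel sets of the Gaussian density are intervals, for which the
   one-dimensional Brunn-Minkowski inequality is just a comparison of end points. *)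
Lemma superlevel_brunn_minkowski (A B : set R) c : measurable A -> measurable B ->
  A !=set0 -> B !=set0 ->
  (forall x y, A x -> B y -> c < n ((x + y) / 2)) ->
  (mu A + mu B <= 2%:E * mu [set u | (c < n u)%R])%E.
Proof.
move=> mA mB [a0 Aa0] [b0 Bb0] AB.
have [c0|c0] := leP c 0.
  rewrite (_ : [set u | _] = `]-oo, +oo[%classic); last first.
    rewrite set_itvNyy; apply/seteqP; split=> // u _ /=.
    by rewrite (le_lt_trans c0)// normal_pdf01_gt0.
  by rewrite lebesgue_measure_itv/= gt0_muley ?leey// lte_fin.
have [rho rhoP] := normal_pdf01_superlevel_bounded c0.
have bA x : A x -> `|x| <= 2 * rho + `|b0|.
  move=> Ax; have := rhoP _ (AB _ _ Ax Bb0); rewrite normrM [X in _ * X]gtr0_norm; last lra.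
  by have := lerB_normD x b0; lra.
have bB x : B x -> `|x| <= 2 * rho + `|a0|.
  move=> Bx; have := rhoP _ (AB _ _ Aa0 Bx); rewrite normrM [X in _ * X]gtr0_norm; last lra.
  by rewrite addrC; have := lerB_normD x a0; lra.
have supA : has_sup A.
  by split; [exists a0|exists (2 * rho + `|b0|) => x /bA; rewrite ler_norml => /andP[]].
have infA : has_inf A.
  split; [by exists a0|exists (- (2 * rho + `|b0|)) => x /bA].
  by rewrite ler_norml => /andP[].
have supB : has_sup B.
  by split; [exists b0|exists (2 * rho + `|a0|) => x /bB; rewrite ler_norml => /andP[]].
have infB : has_inf B.
  split; [by exists b0|exists (- (2 * rho + `|a0|)) => x /bB].
  by rewrite ler_norml => /andP[].
have iAsA : inf A <= sup A.
  by apply: (@le_trans _ _ a0); [exact: ge_inf infA.2 _ Aa0|exact: (sup_upper_bound supA) _ Aa0].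
have iBsB : inf B <= sup B.
  by apply: (@le_trans _ _ b0); [exact: ge_inf infB.2 _ Bb0|exact: (sup_upper_bound supB) _ Bb0].
have itvE (a b : R) : a <= b -> mu `[a, b] = (b - a)%:E.
  rewrite lebesgue_measure_itv/= lte_fin le_eqVlt => /predU1P[->|->].
    by rewrite ltxx subrr.
  by rewrite -EFinD.
have muA : (mu A <= (sup A - inf A)%:E)%E.
  rewrite -itvE//; apply: le_measure; rewrite ?inE// => x Ax.
  by rewrite /= in_itv/=; apply/andP; split; [exact: ge_inf infA.2 _ Ax|exact: (sup_upper_bound supA) _ Ax].
have muB : (mu B <= (sup B - inf B)%:E)%E.
  rewrite -itvE//; apply: le_measure; rewrite ?inE// => x Bx.
  by rewrite /= in_itv/=; apply/andP; split; [exact: ge_inf infB.2 _ Bx|exact: (sup_upper_bound supB) _ Bx].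
apply: (le_trans (leeD muA muB)).
(* The interval of midpoints ]p, q[ has half the total length of the convex hulls of A and B; it
   remains to place it inside the superlevel set. *)
set p := (inf A + inf B) / 2; set q := (sup A + sup B) / 2.
have pq : p <= q by rewrite /p /q; lra.
have -> : ((sup A - inf A)%:E + (sup B - inf B)%:E = 2%:E * (q - p)%:E)%E.
  by rewrite -EFinM -EFinD; congr EFin; rewrite /p /q; field.
rewrite lee_pmul2l//.
have -> : ((q - p)%:E = mu `]p, q[)%E.
  move: pq; rewrite lebesgue_measure_itv/= lte_fin le_eqVlt => /predU1P[->|->].
    by rewrite ltxx subrr.
  by rewrite -EFinD.
apply: le_measure; rewrite ?inE//.
  rewrite -[X in measurable X]setTI.
  by apply: (measurable_fun_ltr (f:=cst c)) => //; exact: measurable_normal_pdf.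
move=> u; rewrite /= in_itv/= => /andP[pu uq].
have up0 : 0 < u - p by lra.
have qu0 : 0 < q - u by lra.
have [x1 Ax1 x1l] := inf_adherent up0 infA.
have [y1 By1 y1l] := inf_adherent up0 infB.
have [x2 Ax2 x2l] := sup_adherent qu0 supA.
have [y2 By2 y2l] := sup_adherent qu0 supB.
have l1 : (x1 + y1) / 2 < u by rewrite /p in x1l y1l; lra.
have l2 : u < (x2 + y2) / 2 by rewrite /q in x2l y2l; lra.
(* The density decreases with the absolute value, so a midpoint beyond u on the side away from 0
   suffices. *)
have [u0|u0] := leP 0 u.
  apply: (normal_pdf01_le_norm (AB _ _ Ax2 By2)).
  by rewrite !ger0_norm//; lra.
apply: (normal_pdf01_le_norm (AB _ _ Ax1 By1)).
by rewrite !ltr0_norm//; lra.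
Qed.


(** The level-set inequality integrated over t. Since both suprema are 1, the superlevel sets of F
    and G are nonempty for the same levels t < 1, as Brunn-Minkowski requires; for t >= 1 both are
    empty. The bound is additive, and the arithmetic-geometric mean inequality later turns it into a
    product. *)
Lemma prekopa_leindler_normalized (F G : R -> R) th : 0 < th ->
  measurable_fun setT F -> measurable_fun setT G ->
  (forall x, 0 <= F x <= 1) -> (forall x, 0 <= G x <= 1) ->
  (forall l, l < 1 -> exists x, l < F x) ->
  (forall l, l < 1 -> exists x, l < G x) ->
  (forall x y, F x * G y <= (n ((x + y) / 2) / th) ^+ 2) ->
  (\int[mu]_x (F x)%:E + \int[mu]_x (G x)%:E <= (2 / th)%:E)%E.
Proof.
move=> th0 mF mG F01 G01 supF supG FG.
have F0 x : 0 <= F x by have /andP[] := F01 x.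
have G0 x : 0 <= G x by have /andP[] := G01 x.
pose H x := n x / th.
have mH : measurable_fun setT H.
  by apply: measurable_funM => //; exact: measurable_normal_pdf.
have H0 x : 0 <= H x by rewrite divr_ge0 ?normal_pdf_ge0// ltW.
have HE : (\int[mu]_x (H x)%:E = (th^-1)%:E)%E.
  under eq_integral do rewrite EFinM muleC.
  rewrite ge0_integralZl//= ?integral_normal_pdf ?mule1//.
  - by apply/measurable_EFinP; exact: measurable_normal_pdf.
  - by move=> x _; rewrite lee_fin normal_pdf_ge0.
  - by rewrite lee_fin invr_ge0 ltW.
have my K : measurable_fun setT K -> measurable_fun setT
    (fun t => mu (ysection (subgraph K) t)).
  move=> mK; apply: measurable_fun_ysection; exact: measurable_subgraph.
rewrite EFinM -HE !layer_cake// -ge0_integralD//; [|exact: my..].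
rewrite -ge0_integralZl//; [|exact: my].
apply: ge0_le_integral => //.
- by move=> t _; rewrite adde_ge0.
- by apply: emeasurable_funD; exact: my.
- by apply: emeasurable_funM => //; exact: my.
move=> t _; rewrite !ysection_subgraph.
case: ifPn => [t0|_]; last by rewrite !measure0 mule0 adde0.
have [t1|t1] := ltP t 1; last first.
  rewrite (_ : [set x | t < F x] = set0); last first.
    apply/seteqP; split=> // x /=; apply/negP; rewrite -leNgt.
    by have /andP[_ h] := F01 x; exact: le_trans h t1.
  rewrite (_ : [set x | t < G x] = set0); last first.
    apply/seteqP; split=> // x /=; apply/negP; rewrite -leNgt.
    by have /andP[_ h] := G01 x; exact: le_trans h t1.
  by rewrite !measure0 adde0 mule_ge0.
rewrite (_ : [set x | t < H x] = [set x | t * th < n x]); last first.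
  by apply/seteqP; split=> x /=; rewrite /H ltr_pdivlMr.
apply: superlevel_brunn_minkowski; [exact: measurable_superlevel|exact: measurable_superlevel|exact: supF|exact: supG|].
move=> x y /= tF tG; rewrite -ltr_pdivlMr//.
rewrite -(@ltr_pXn2r _ 2)// ?nnegrE ?divr_ge0 ?normal_pdf_ge0// ?(ltW th0)//.
by apply: lt_le_trans (FG x y); rewrite expr2 ltr_pM.
Qed.

Lemma gaussian_property_tau1 (f g : R -> R) M :
  measurable_fun setT f -> measurable_fun setT g ->
  (forall x, 0 <= f x <= M) -> (forall x, 0 <= g x <= M) ->
  (forall x y, f x * g y <= expR ((x - y) ^+ 2 / 4)) ->
  (\int[normal_prob 0 1]_x (f x)%:E * \int[normal_prob 0 1]_x (g x)%:E <= 1)%E.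
Proof.
move=> mf mg f0M g0M fg.
have f0 x : 0 <= f x by have /andP[] := f0M x.
have g0 x : 0 <= g x by have /andP[] := g0M x.
have M0 : 0 <= M by have /andP[/le_trans+ h] := f0M 0; exact.
rewrite !ge0_integral_normal//.
pose F x := f x * n x; pose G x := g x * n x.
have mn := @measurable_normal_pdf R 0 1.
have bd k : (forall x, 0 <= k x <= M) ->
    ubound (range (fun x => k x * n x)) (M * normal_peak 1).
  move=> kM _ [x _ <-]; have /andP[k0 km] := kM x.
  by rewrite ler_pM ?normal_pdf_ge0 ?normal_pdf_ub ?oner_eq0.
pose al := sup (range F); pose be := sup (range G).
have sF : has_sup (range F).
  by split; [exists (F 0), 0|exists (M * normal_peak 1); exact: bd].
have sG : has_sup (range G).
  by split; [exists (G 0), 0|exists (M * normal_peak 1); exact: bd].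
have Fal x : F x <= al by apply: (sup_upper_bound sF); exists x.
have Gbe x : G x <= be by apply: (sup_upper_bound sG); exists x.
have F0 x : 0 <= F x by rewrite mulr_ge0 ?normal_pdf_ge0.
have G0 x : 0 <= G x by rewrite mulr_ge0 ?normal_pdf_ge0.
have [al0|al0] := leP al 0.
  rewrite [X in (X * _)%E]integral0_eq ?mul0e// => x _; congr EFin.
  by apply/eqP; rewrite eq_le F0 (le_trans (Fal x) al0).
have [be0|be0] := leP be 0.
  rewrite [X in (_ * X)%E]integral0_eq ?mule0// => x _; congr EFin.
  by apply/eqP; rewrite eq_le G0 (le_trans (Gbe x) be0).
(* Dividing F and G by their suprema divides the bound n((x + y) / 2)^2 by [al * be], that is, n by
   the geometric mean of the suprema. Boundedness of f and g makes these suprema finite. *)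
pose th := Num.sqrt (al * be).
have th0 : 0 < th by rewrite sqrtr_gt0 mulr_gt0.
have th2 : th ^+ 2 = al * be by rewrite sqr_sqrtr// ltW// mulr_gt0.
have mF : measurable_fun setT F by exact: measurable_funM.
have mG : measurable_fun setT G by exact: measurable_funM.
have key := @prekopa_leindler_normalized (fun x => F x / al) (fun x => G x / be) th th0.
have {}key : (\int[mu]_x (F x / al)%:E + \int[mu]_x (G x / be)%:E <= (2 / th)%:E)%E.
  apply: key.
  - exact: measurable_funM.
  - exact: measurable_funM.
  - by move=> x; rewrite divr_ge0 ?(ltW al0)//= ler_pdivrMr// mul1r.
  - by move=> x; rewrite divr_ge0 ?(ltW be0)//= ler_pdivrMr// mul1r.
  - move=> l l1; have [_ [x _ <-] h] : exists2 y, range F y & al - (al - l * al) < y.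
      by apply: sup_adherent => //; rewrite subr_gt0 gtr_pMl.
    by exists x; rewrite ltr_pdivlMr//; move: h; rewrite opprB addrC subrK.
  - move=> l l1; have [_ [x _ <-] h] : exists2 y, range G y & be - (be - l * be) < y.
      by apply: sup_adherent => //; rewrite subr_gt0 gtr_pMl.
    by exists x; rewrite ltr_pdivlMr//; move: h; rewrite opprB addrC subrK.
  move=> x y; rewrite [leRHS]expr_div_n th2 mulrACA -invfM.
  rewrite ler_pM2r ?invr_gt0 ?mulr_gt0//.
  rewrite -normal_pdf01_midpoint /F /G mulrACA mulrC.
  by rewrite ler_pM2l// mulr_gt0// normal_pdf01_gt0.
have intZ (K : R -> R) c : 0 < c -> measurable_fun setT K -> (forall x, 0 <= K x) ->
    (\int[mu]_x (K x / c)%:E = (\int[mu]_x (K x)%:E) * (c^-1)%:E)%E.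
  move=> c0 mK K0; under eq_integral do rewrite EFinM.
  rewrite ge0_integralZr//; [exact/measurable_EFinP|by move=> x _; rewrite lee_fin|by rewrite lee_fin invr_ge0 ltW].
move: key; rewrite !intZ//.
have fin (K : R -> R) : (forall x, 0 <= K x <= M) -> measurable_fun setT K ->
   (\int[mu]_x (K x * n x)%:E)%E \is a fin_num.
  move=> KM mK; rewrite ge0_fin_numE; last first.
    by apply: integral_ge0 => x _; rewrite lee_fin mulr_ge0 ?normal_pdf_ge0//;
      have /andP[] := KM x.
  apply: (@le_lt_trans _ _ (\int[mu]_x (M * n x)%:E)%E).
    apply: ge0_le_integral => //.
    - by move=> x _; rewrite lee_fin mulr_ge0 ?normal_pdf_ge0//;
        have /andP[] := KM x.
    - by apply/measurable_EFinP; exact: measurable_funM.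
    - by apply/measurable_EFinP; exact: measurable_funM.
    - by move=> x _; rewrite lee_fin ler_wpM2r ?normal_pdf_ge0//;
        have /andP[] := KM x.
  under eq_integral do rewrite EFinM.
  rewrite ge0_integralZl//= ?integral_normal_pdf ?mule1 ?ltry//.
  - by apply/measurable_EFinP.
  - by move=> x _; rewrite lee_fin normal_pdf_ge0.
have := fin f f0M mf; have := fin g g0M mg.
have : (0 <= \int[mu]_x (f x * n x)%:E)%E by apply: integral_ge0 => x _; rewrite lee_fin F0.
have : (0 <= \int[mu]_x (g x * n x)%:E)%E by apply: integral_ge0 => x _; rewrite lee_fin G0.
rewrite -/F -/G.
case: (\int[mu]_x (f x * n x)%:E)%E => // a; case: (\int[mu]_x (g x * n x)%:E)%E => // b.
rewrite !lee_fin => b0 a0 _ _ h.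
(* Arithmetic-geometric mean: two nonnegative numbers with sum at most 2/th have product at most
   1/th^2. *)
have h2 : (a / al) * (b / be) <= (th ^-1) ^+ 2.
  have : 0 <= (a / al - b / be) ^+ 2 by exact: sqr_ge0.
  have : 0 <= a / al by rewrite divr_ge0// ltW.
  have : 0 <= b / be by rewrite divr_ge0// ltW.
  have : 0 < th^-1 by rewrite invr_gt0.
  move: h; set u := a / al; set v := b / be; set w := th^-1.
  nra.
move: h2; rewrite exprVn th2 mulrACA -invfM -[leRHS]mul1r.
by rewrite ler_pM2r// invr_gt0 mulr_gt0.
Qed.

End prekopa.

(** * Property (tau) for product Gaussian measures *)

Section gaussian_space.
Context (R : realType).

(** The display of a product of measurable types depends on those of its factors, so each type is
    packed with its display. The iterated product ends in [unit], which makes dimension 0 the base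
    of every induction. *)
Fixpoint gauss_space (k : nat) : {d & measurableType d} :=
  if k is k'.+1 then
    existT (fun d => measurableType d) _ (measurableTypeR R * projT2 (gauss_space k'))%type
  else existT (fun d => measurableType d) _ unit.

Notation T k := (projT2 (gauss_space k)).

Fixpoint gauss_measure (k : nat) : probability (T k) R :=
  if k is k'.+1 then (normal_prob 0 1 \x gauss_measure k')%E else \d_tt.

Fixpoint sqdist (k : nat) : T k -> T k -> R :=
  if k is k'.+1 then fun z w => (z.1 - w.1) ^+ 2 + sqdist z.2 w.2
  else fun _ _ => 0.

(** Tensorization. For fixed first coordinates x and y, the induction hypothesis applies to the
    sections of f and g once the first-coordinate cost has been moved onto f; it says that the
    partial integrals F(x) and G(y) satisfy the one-dimensional hypothesis. *)
Lemma gaussian_property_tau k (f g : T k -> R) M :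
  measurable_fun setT f -> measurable_fun setT g ->
  (forall x, 0 <= f x <= M) -> (forall x, 0 <= g x <= M) ->
  (forall x y, f x * g y <= expR (sqdist x y / 4)) ->
  (\int[gauss_measure k]_x (f x)%:E * \int[gauss_measure k]_x (g x)%:E <= 1)%E.
Proof.
elim: k f g => [|k IH] f g mf mg f0M g0M fg.
  rewrite !integral_dirac ?diracT ?mul1e//; try exact/measurable_EFinP.
  rewrite -EFinM lee_fin.
  by have := fg tt tt; rewrite /= mul0r expR0.
have bd (h : T k.+1 -> R) : (forall x, 0 <= h x <= M) -> measurable_fun setT h ->
    forall x, (0 <= fubini_F (gauss_measure k) (EFin \o h) x <= M%:E)%E.
  move=> hM mh x; apply/andP; split.
    by apply: integral_ge0 => y _; rewrite lee_fin; have /andP[] := hM (x, y).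
  have -> : (M%:E = \int[gauss_measure k]_y M%:E)%E.
    rewrite integral_cst// -[LHS]mule1; congr (_ * _)%E.
    by apply: esym; exact: probability_setT.
  apply: ge0_le_integral => //.
  - by move=> y _; rewrite lee_fin; have /andP[] := hM (x, y).
  - apply/measurable_EFinP.
    exact: (measurableT_comp mh (pair1_measurable x)).
  - by move=> y _; rewrite lee_fin; have /andP[] := hM (x, y).
have fubF (h : T k.+1 -> R) : (forall x, 0 <= h x <= M) -> measurable_fun setT h ->
    exists2 H : R -> R, measurable_fun setT H /\ (forall x, 0 <= H x <= M) &
    (forall x, (\int[gauss_measure k]_y (h (x, y))%:E = (H x)%:E)%E) /\
    (\int[gauss_measure k.+1]_x (h x)%:E = \int[normal_prob 0 1]_x (H x)%:E)%E.
  move=> hM mh.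
  have h0 z : (0 <= (EFin \o h) z)%E by rewrite lee_fin; have /andP[] := hM z.
  have mh' : measurable_fun setT (EFin \o h) by exact/measurable_EFinP.
  have HE x : (fubini_F (gauss_measure k) (EFin \o h) x =
      (fine (fubini_F (gauss_measure k) (EFin \o h) x))%:E)%E.
    by rewrite fineK// fin_numElt; have /andP[a b] := bd h hM mh x;
      rewrite (lt_le_trans _ a)//= (le_lt_trans b)// ltry.
  exists (fun x => fine (fubini_F (gauss_measure k) (EFin \o h) x)).
    split.
      apply: measurableT_comp => //.
      exact: (@measurable_fun_fubini_tonelli_F _ _ _ _ _ (gauss_measure k)).
    by move=> x; have := bd h hM mh x; rewrite HE !lee_fin.
  split=> [x|]; first exact: HE.
  rewrite [LHS](@fubini_tonelli1 _ _ _ _ _ (normal_prob 0 1) (gauss_measure k)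
    (EFin \o h))//.
  by apply: eq_integral => x _; rewrite -HE.
have [F [mF FM] [FE ->]] := fubF f f0M mf.
have [G [mG GM] [GE ->]] := fubF g g0M mg.
apply: (gaussian_property_tau1 (M := M)) => // x y.
have e0 : 0 < expR ((x - y) ^+ 2 / 4) by exact: expR_gt0.
(* Since c <= 1, the rescaled section of f keeps the bound M. *)
pose c := (expR ((x - y) ^+ 2 / 4))^-1.
have c0 : 0 < c by rewrite invr_gt0.
rewrite -[leRHS]mul1r -ler_pdivrMr// -/c.
have M0 : 0 <= M by have /andP[/le_trans+ h] := FM 0; exact.
have cE : (\int[gauss_measure k]_z (c * f (x, z))%:E = (c * F x)%:E)%E.
  under eq_integral do rewrite EFinM.
  rewrite ge0_integralZl//= ?FE//.
  - apply/measurable_EFinP; exact: (measurableT_comp mf (pair1_measurable x)).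
  - by move=> z _; rewrite lee_fin; have /andP[] := f0M (x, z).
  - by rewrite lee_fin ltW.
rewrite mulrC mulrA -lee_fin EFinM -cE -GE.
apply: (IH _ _).
- apply: measurable_funM => //; exact: (measurableT_comp mf (pair1_measurable x)).
- exact: (measurableT_comp mg (pair1_measurable y)).
- move=> z; have /andP[f0 fM] := f0M (x, z).
  rewrite mulr_ge0 ?(ltW c0)//= (le_trans _ fM)// ler_piMl//.
  by rewrite /c invf_le1// -expR0 ler_expR divr_ge0// sqr_ge0.
- by move=> z.
move=> z w; rewrite -mulrA mulrC ler_pdivrMr//.
apply: (le_trans (fg _ _)).
by rewrite /= -expRD addrC mulrDl.
Qed.

(** Property (tau) for [\1_X] and [expR (c / 4) * \1_Y]: their product vanishes off X x Y, where the
    cost is at least exp(c / 4). *)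
Lemma gauss_measure_separated k (X Y : set (T k)) c :
  measurable X -> measurable Y ->
  (forall x y, X x -> Y y -> c <= sqdist x y) ->
  (gauss_measure k X * gauss_measure k Y <= (expR (- (c / 4)))%:E)%E.
Proof.
move=> mX mY XY.
have e0 : 0 < expR (c / 4) by exact: expR_gt0.
have key : (\int[gauss_measure k]_x (\1_X x)%:E *
    \int[gauss_measure k]_x (expR (c / 4) * \1_Y x)%:E <= 1)%E.
  apply: (gaussian_property_tau (M := 1 + expR (c / 4))).
  - exact: measurable_indic.
  - by apply: measurable_funM => //; exact: measurable_indic.
  - by move=> x; rewrite indicE; case: (x \in X) => /=; lra.
  - by move=> x; rewrite indicE; case: (x \in Y) => /=; rewrite ?mulr1 ?mulr0; lra.
  move=> x y; rewrite !indicE; case: (boolP (x \in X)) => [|_]; last by rewrite mul0r expR_ge0.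
  rewrite inE => Xx; case: (boolP (y \in Y)) => [|_]; last by rewrite !mulr0 expR_ge0.
  by rewrite inE => Yy; rewrite mul1r mulr1 ler_expR ler_pM2r// XY.
move: key; rewrite integral_indic// setIT.
under eq_integral do rewrite EFinM.
rewrite ge0_integralZl//=; last exact/measurable_EFinP/measurable_indic.
rewrite integral_indic// setIT muleCA expRN.
move=> h; rewrite -(@lee_pmul2l _ (expR (c / 4))%:E)//.
by rewrite -EFinM divff// gt_eqF.
Qed.

(** Half-open cubes of side [delta]. Indexing by integer lists gives one countable index type for
    all dimensions; [head 0] reads a missing coordinate as 0. *)
Fixpoint grid_cell (delta : R) (k : nat) : seq int -> set (T k) :=
  if k is k'.+1 then fun v =>
    [set z : T k'.+1 | delta * (head 0 v)%:~R <= z.1 < delta * (head 0 v + 1)%:~R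
       /\ grid_cell delta (behead v) z.2]
  else fun _ => setT.

Lemma measurable_grid_cell delta k v : measurable (@grid_cell delta k v).
Proof.
elim: k v => [|k IH] v; first exact: measurableT.
rewrite (_ : @grid_cell delta k.+1 v = `[delta * (head 0 v)%:~R, delta * (head 0 v + 1)%:~R[%classic
   `*` @grid_cell delta k (behead v) :> set (T k.+1)).
  by apply: measurableX.
by apply/seteqP; split=> -[z w] /=; rewrite in_itv.
Qed.

Lemma grid_cell_ex delta k (z : T k) : 0 < delta -> exists v, grid_cell delta v z.
Proof.
move=> d0; elim: k z => [|k IH] z; first by exists [::].
have [v vz] := IH z.2.
exists (Num.floor (z.1 / delta) :: v); split => //=.
rewrite mulrC -ler_pdivlMr// floor_le/= mulrC -ltr_pdivrMr//.
exact: floorD1_gt.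
Qed.

Lemma sqdist_grid_cell delta k v (z w : T k) : grid_cell delta v z ->
  grid_cell delta v w -> sqdist z w <= k%:R * delta ^+ 2.
Proof.
elim: k v z w => [|k IH] v z w; first by rewrite mul0r.
move=> [/andP[z1 z2] zv] [/andP[w1 w2] wv].
rewrite -natr1 mulrDl mul1r addrC [leRHS]addrC /=.
rewrite [leLHS]addrC lerD ?(IH (behead v))//.
rewrite intrD mulrDr mulr1 in z2 w2.
rewrite -(real_normK (num_real (z.1 - w.1))).
have d0 : 0 <= delta by lra.
by rewrite lerXn2r ?nnegrE// ler_norml; apply/andP; split; lra.
Qed.

Lemma sqdistC k (z w : T k) : sqdist z w = sqdist w z.
Proof. by elim: k z w => //= k IH z w; rewrite IH; congr (_ + _); ring. Qed.

Lemma sqdist_triangle3 k (a b c e : T k) :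
  sqdist a e <= 3 * (sqdist a b + sqdist b c + sqdist c e).
Proof.
elim: k a b c e => /= [|k IH] a b c e; first by rewrite !addr0 mulr0.
have := IH a.2 b.2 c.2 e.2.
have : (a.1 - e.1) ^+ 2 <=
    3 * ((a.1 - b.1) ^+ 2 + (b.1 - c.1) ^+ 2 + (c.1 - e.1) ^+ 2).
  have := sqr_ge0 ((a.1 - b.1) - (b.1 - c.1)).
  have := sqr_ge0 ((b.1 - c.1) - (c.1 - e.1)).
  have := sqr_ge0 ((a.1 - b.1) - (c.1 - e.1)).
  by lra.
lra.
Qed.

(** X is the union of the cells that meet A: a countable union, hence measurable even when A is
    not. *)
Lemma grid_hull k (A : set (T k)) e : 0 < e -> exists X : set (T k),
  [/\ measurable X, A `<=` X & forall x, X x -> exists2 a, A a & sqdist a x <= e].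
Proof.
(* A cell has squared diameter at most k delta^2; dividing by k + 1 rather than k also covers
   dimension 0. *)
move=> e0; pose delta := Num.sqrt (e / k.+1%:R).
have d0 : 0 < delta by rewrite sqrtr_gt0 divr_gt0.
have dk : k%:R * delta ^+ 2 <= e.
  rewrite sqr_sqrtr ?divr_ge0 ?(ltW e0)// mulrCA ler_piMr ?(ltW e0)//.
  by rewrite ler_pdivrMr// mul1r ler_nat.
exists (\bigcup_(v in [set v | grid_cell delta v `&` A !=set0]) grid_cell delta v).
split.
- rewrite bigcup_mkcond; apply: countable_bigcupT_measurable => // v.
  by case: ifP => // _; exact: measurable_grid_cell.
- move=> a Aa; have [v va] := grid_cell_ex a d0.
  by exists v => //; exists a.
- move=> x [v [a [va Aa]] vx]; exists a => //.
  exact: le_trans (sqdist_grid_cell va vx) dk.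
Qed.

(** Each hull adds squared distance at most 1/2. By convexity of the square, c <= 3 (1/2 + |x - y|^2
    + 1/2) for x in X and y in Y, so the hulls are still at squared distance at least c/3 - 1. *)
Lemma gauss_measure_separated_hulls k (A B : set (T k)) c :
  (forall a b, A a -> B b -> c <= sqdist a b) ->
  exists X Y : set (T k), [/\ measurable X, measurable Y, A `<=` X, B `<=` Y &
    (gauss_measure k X * gauss_measure k Y <= (expR ((1 - c / 3) / 4))%:E)%E].
Proof.
move=> AB; have h0 : 0 < 1 / 2 :> R by lra.
have [X [mX AX XA]] := grid_hull A h0.
have [Y [mY BY YB]] := grid_hull B h0.
exists X, Y; split => //.
rewrite (_ : (1 - c / 3) / 4 = - ((c / 3 - 1) / 4)); last by ring.
apply: gauss_measure_separated => // x y /XA[a Aa ax] /YB[b Bb yb].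
have := sqdist_triangle3 a x y b; have := AB _ _ Aa Bb.
rewrite (sqdistC y b); lra.
Qed.

End gaussian_space.

(** * One-dimensional normal laws *)

Section normal_affine.
Context (R : realType).
Local Notation mu := (@lebesgue_measure R).
Local Notation N := (normal_prob (0 : R) 1).
Implicit Types f : R -> R.

(** Positive and negative parts of a continuous function are continuous, so an identity between
    integrals of nonnegative continuous functions extends to all continuous functions, as an
    equality of extended reals. *)
Lemma integral_ge0_ext d1 d2 (T1 : measurableType d1) (T2 : measurableType d2)
    (P1 : {measure set T1 -> \bar R}) (P2 : {measure set T2 -> \bar R})
    (X1 : T1 -> R) (X2 : T2 -> R) :
  (forall f, continuous f -> (forall x, 0 <= f x)%R ->
     \int[P1]_w (f (X1 w))%:E = \int[P2]_w (f (X2 w))%:E)%E ->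
  forall f, continuous f ->
     (\int[P1]_w (f (X1 w))%:E = \int[P2]_w (f (X2 w))%:E)%E.
Proof.
move=> H f cf; rewrite integralE [RHS]integralE; congr (_ - _)%E.
- have cp : continuous (f \max cst 0 : R -> R).
    by move=> x; apply: (@continuous_max R R f (cst 0)); [exact: cf|exact: cst_continuous].
  have p0 x : 0 <= (f \max cst 0) x by rewrite /= le_max lexx orbT.
  have E d (T : measurableType d) (P : {measure set T -> \bar R}) X :
      (\int[P]_w (((fun w => (f (X w))%:E)^\+)%E w) =
       \int[P]_w ((f \max cst 0) (X w))%:E)%E.
    by apply: eq_integral => w _; rewrite funeposE /= EFin_max.
  by rewrite !E H.
- have cp : continuous ((\- f)%R \max cst 0 : R -> R).
    move=> x; apply: (@continuous_max R R (\- f)%R (cst 0)); last exact: cst_continuous.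
    by apply: continuousN; exact: cf.
  have p0 x : 0 <= ((\- f)%R \max cst 0) x by rewrite /= le_max lexx orbT.
  have E d (T : measurableType d) (P : {measure set T -> \bar R}) X :
      (\int[P]_w (((fun w => (f (X w))%:E)^\-)%E w) =
       \int[P]_w (((\- f)%R \max cst 0) (X w))%:E)%E.
    by apply: eq_integral => w _; rewrite funenegE /= EFin_max.
  by rewrite !E H.
Qed.

Lemma integral_normal_affine (m s : R) f : 0 < s -> continuous f ->
  (\int[normal_prob m s]_x (f x)%:E = \int[N]_x (f (m + s * x))%:E)%E.
Proof.
move=> s0; move: f.
apply: (@integral_ge0_ext _ _ _ _ (normal_prob m s) N id (fun x => m + s * x)).
move=> f cf f0.
have s_neq0 : s != 0 by rewrite gt_eqF.
pose F (x : R) := m + s * x.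
have dF (x : R) : is_derive x 1 F s.
  by rewrite /F; apply: is_derive_eq; rewrite add0r mul1r /GRing.scale/= mulr1.
have F'E : F^`()%classic = cst s.
  by apply/funext => x; rewrite derive1E; exact: derive_val.
have cF : continuous F.
  by move=> x; apply: differentiable_continuous; apply/derivable1_diffP; exact: ex_derive.
rewrite [LHS]ge0_integral_normal//; last exact: continuous_measurable_fun.
rewrite (@increasing_ge0_integration_by_substitutionT _ F).
- rewrite F'E [RHS]ge0_integral_normal//; last first.
    by apply: continuous_measurable_fun => x; apply: continuous_comp; [exact: cF|exact: cf].
  apply: eq_integral => x _; congr EFin; rewrite !fctE -mulrA; congr (_ * _).
  rewrite !normal_pdfE ?oner_eq0//= mulrAC; congr (_ * _).
    rewrite /normal_peak -mulrnAr sqrtrM ?sqr_ge0// sqrtr_sqr gtr0_norm// invfM.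
    by rewrite -mulrnAr expr1n mul1r mulrC mulrA divff// mul1r.
  rewrite /normal_fun /F; congr expR; rewrite subr0 addrC addKr.
  by rewrite expr1n exprMn; field.
- by move=> x y xy; rewrite /F ltrD2l ltr_pM2l.
- by rewrite F'E => x; exact: cst_continuous.
- by rewrite F'E; exact: is_cvg_cst.
- by rewrite F'E; exact: is_cvg_cst.
- by move=> x; exact: ex_derive.
- exact: cvg_comp (gt0_cvgMrNy s0 cvg_id) (cvg_addrl_Ny m).
- exact: cvg_comp (gt0_cvgMry s0 cvg_id) (cvg_addrl m).
- move=> x; apply: continuousM; first exact: cf.
  exact: continuous_normal_pdf.
- by move=> x; rewrite mulr_ge0// normal_pdf_ge0.
Qed.

Lemma integral_normal_opp f : continuous f ->
  (\int[N]_x (f (- x))%:E = \int[N]_x (f x)%:E)%E.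
Proof.
move: f; apply: (@integral_ge0_ext _ _ _ _ N N -%R id).
move=> f cf f0.
have cfN : continuous (f \o -%R).
  by move=> x; apply: continuous_comp; [exact: opp_continuous|exact: cf].
rewrite !ge0_integral_normal//; [|exact: continuous_measurable_fun..].
pose G x := f x * normal_pdf 0 1 x.
have cG : continuous G.
  move=> x; apply: continuousM; first exact: cf.
  by apply: continuous_normal_pdf; exact: oner_neq0.
have cGN : continuous (G \o -%R).
  by move=> x; apply: continuous_comp; [exact: opp_continuous|exact: cG].
have G0 x : 0 <= G x by rewrite mulr_ge0 ?normal_pdf_ge0.
have GN x : f (- x) * normal_pdf 0 1 x = G (- x).
  rewrite /G; congr (_ * _); rewrite !normal_pdfE ?oner_eq0//=; congr (_ * _).
  by rewrite /normal_fun !subr0 sqrrN.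
under eq_integral do rewrite GN.
(* Both half-lines are carried to [0, +oo[, so that replacing H by its reflection merely swaps the
   two terms. *)
have split (H : R -> R) : continuous H -> (forall x, 0 <= H x) ->
    (\int[mu]_x (H x)%:E = \int[mu]_(x in `[0%R, +oo[) (H (- x))%:E +
       \int[mu]_(x in `[0%R, +oo[) (H x)%:E)%E.
  move=> cH H0.
  have mH : measurable_fun setT (EFin \o H).
    by apply/measurable_EFinP; exact: continuous_measurable_fun.
  rewrite -[in LHS](itv_setU_setT false (0 : R)) ge0_integral_setU//=.
  - rewrite integral_itv_obnd_cbnd; last exact: measurable_funS mH.
    congr (_ + _)%E.
    have := @ge0_integration_by_substitutionNy R H 0; rewrite oppr0 => -> //.
    by apply: continuous_subspaceT.
  - exact: measurable_funS mH.
  - by move=> x _; rewrite lee_fin.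
  - apply/disj_set2P; apply/seteqP; split => // x [] /=; rewrite !in_itv/= andbT.
    by move=> /le_lt_trans h/h; rewrite ltxx.
rewrite (split G)// (split (G \o -%R))//= addeC; congr (_ + _)%E.
by apply: eq_integral => x _; rewrite opprK.
Qed.

End normal_affine.

Section bounded.
Context d (T : measurableType d) (R : realType) (P : {finite_measure set T -> \bar R}).

Lemma bounded_integrable (f : T -> R) M : measurable_fun setT f ->
  (forall x, `|f x| <= M) -> P.-integrable setT (EFin \o f).
Proof.
move=> mf fM; apply: measurable_bounded_integrable => //.
  by rewrite -ge0_fin_numE// fin_num_measure.
by exists M; split; [exact: num_real|move=> N MN x _ /=; exact: le_trans (fM x) (ltW MN)].
Qed.

Lemma measurable_cos_comp (f : T -> R) : measurable_fun setT f ->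
  measurable_fun setT (fun x => cos (f x)).
Proof. by move=> mf; exact: measurableT_comp (continuous_measurable_fun (@continuous_cos R)) mf. Qed.

Lemma cos_integrable (f : T -> R) : measurable_fun setT f ->
  P.-integrable setT (EFin \o (fun x => cos (f x))).
Proof.
move=> mf; apply: (@bounded_integrable _ 1); first exact: measurable_cos_comp.
by move=> x; rewrite ler_norml cos_geN1 cos_le1.
Qed.

End bounded.

(** * Second moment and cosine transform of normal laws *)

Section normal_moments.
Context (R : realType).
Local Notation N := (normal_prob (0 : R) 1).

Lemma continuous_affine (a b : R) : continuous (fun x : R => a + b * x).
Proof.
by move=> x; apply: continuousD; [exact: cst_continuous|exact: mulrl_continuous].
Qed.

Lemma continuous_sqr : continuous (fun x : R => x ^+ 2).
Proof. exact: (@exprn_continuous R 2). Qed.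

Lemma measurable_sqr : measurable_fun setT (fun x : R => x ^+ 2).
Proof. exact: continuous_measurable_fun continuous_sqr. Qed.

(** The second moment of the standard normal law, kept as a symbol; finiteness and strict positivity
    are established below. *)
Definition normal_sqr : R := fine (\int[N]_x (x ^+ 2)%:E).

(** From x^2/4 <= exp(x^2/4), the integrand x^2 exp(-x^2/2) is at most 4 exp(-x^2/4), a multiple of
    the normal density with standard deviation sqrt 2. *)
Lemma integral_sqr_fin : (\int[N]_x (x ^+ 2)%:E < +oo)%E.
Proof.
rewrite ge0_integral_normal//; last by move=> x; exact: sqr_ge0.
pose C : R := 4 * normal_peak 1 / normal_peak (Num.sqrt 2).
have s2 : Num.sqrt 2 != 0 :> R by rewrite gt_eqF// sqrtr_gt0.
apply: (@le_lt_trans _ _ (\int[lebesgue_measure]_x (C * normal_pdf 0 (Num.sqrt 2) x)%:E)%E).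
  apply: ge0_le_integral => //.
  - by move=> x _; rewrite lee_fin mulr_ge0 ?sqr_ge0 ?normal_pdf_ge0.
  - apply/measurable_EFinP/measurable_funM; last exact: measurable_normal_pdf.
    exact: measurable_sqr.
  - by apply/measurable_EFinP/measurable_funM => //; exact: measurable_normal_pdf.
  move=> x _; rewrite lee_fin !normal_pdfE ?oner_eq0//= /C.
  rewrite [leRHS]mulrA divfK ?gt_eqF ?normal_peak_gt0// /normal_fun !subr0 sqr_sqrtr//.
  have p0 : 0 < normal_peak (1 : R) by rewrite normal_peak_gt0// oner_eq0.
  rewrite mulrCA -[leRHS]mulrA [leRHS]mulrCA ler_pM2l//.
  have -> : - x ^+ 2 / (1 ^+ 2 *+ 2) = - (x ^+ 2 / 4) + - (x ^+ 2 / 4) by field.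
  have -> : - x ^+ 2 / (2 *+ 2) = - (x ^+ 2 / 4) by field.
  have e0 := expR_gt0 (- (x ^+ 2 / 4)).
  rewrite expRD mulrA ler_pM2r// mulrC expRN ler_pdivrMl ?expR_gt0//.
  by have := expR_ge1Dx (x ^+ 2 / 4); lra.
under eq_integral do rewrite EFinM.
rewrite ge0_integralZl//= ?integral_normal_pdf ?mule1 ?ltry//.
- by apply/measurable_EFinP; exact: measurable_normal_pdf.
- by move=> x _; rewrite lee_fin normal_pdf_ge0.
- by rewrite lee_fin /C divr_ge0 ?normal_peak_ge0// mulr_ge0 ?normal_peak_ge0.
Qed.

Lemma integral_normal_sqr : (\int[N]_x (x ^+ 2)%:E = normal_sqr%:E)%E.
Proof.
rewrite /normal_sqr fineK// ge0_fin_numE ?integral_sqr_fin//.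
by apply: integral_ge0 => x _; rewrite lee_fin sqr_ge0.
Qed.

Lemma normal_sqr_gt0 : 0 < normal_sqr.
Proof.
rewrite -lte_fin -integral_normal_sqr ge0_integral_normal; last 2 first.
- exact: measurable_sqr.
- by move=> x; exact: sqr_ge0.
apply: (@lt_le_trans _ _ (\int[lebesgue_measure]_(x in `[1%R, 2%R]) (normal_pdf 0 1 2)%:E)%E).
  rewrite integral_cst//= lebesgue_measure_itv/= lte_fin ltr1n -EFinB.
  rewrite -EFinM lte_fin mulr_gt0//.
  by rewrite normal_pdfE ?oner_eq0//= mulr_gt0 ?expR_gt0// normal_peak_gt0// oner_eq0.
apply: (@le_trans _ _ (\int[lebesgue_measure]_(x in `[1%R, 2%R]) (x ^+ 2 * normal_pdf 0 1 x)%:E)%E).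
  apply: ge0_le_integral => //.
  - by move=> x _; rewrite lee_fin normal_pdf_ge0.
  - apply/measurable_EFinP/measurable_funTS/measurable_funM; last exact: measurable_normal_pdf.
    exact: measurable_sqr.
  move=> x; rewrite /= in_itv/= => /andP[x1 x2]; rewrite lee_fin.
  have x21 : 1 <= x ^+ 2 by rewrite expr_ge1// (le_trans ler01).
  rewrite -[leLHS]mul1r ler_pM ?normal_pdf_ge0//.
  rewrite !normal_pdfE ?oner_eq0//= ler_wpM2l ?normal_peak_ge0//.
  rewrite /normal_fun !subr0 ler_expR ler_pM2r ?invr_gt0// lerN2.
  by rewrite lerXn2r ?nnegrE// (le_trans ler01).
apply: ge0_subset_integral => //.
- apply/measurable_EFinP/measurable_funM; last exact: measurable_normal_pdf.
  exact: measurable_sqr.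
- by move=> x _; rewrite lee_fin mulr_ge0 ?sqr_ge0 ?normal_pdf_ge0.
Qed.

Lemma Lfun2P d (T : measurableType d) (P : probability T R) (X : T -> R) :
  measurable_fun setT X -> (\int[P]_w (X w ^+ 2)%:E < +oo)%E -> X \in Lfun P 2%:E.
Proof.
move=> mX X2; rewrite inE; apply/andP; split; rewrite inE//= /finite_norm unlock.
apply: poweR_lty; apply: le_lt_trans X2.
rewrite le_eqVlt; apply/orP; left; apply/eqP; apply: eq_integral => w _ /=.
by rewrite powR_mulrn// -normrX ger0_norm// sqr_ge0.
Qed.

Lemma integral_normal_id : (\int[N]_x x%:E = 0)%E.
Proof.
have cid : continuous (fun x : R => x) by move=> x; exact: cvg_id.
have Nint : N.-integrable setT (EFin \o (fun x : R => x)).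
  apply/Lfun1_integrable.
  apply: Lfun_subset12; first by apply: fin_num_measure.
  by apply: Lfun2P; [exact: continuous_measurable_fun|exact: integral_sqr_fin].
have := integral_normal_opp cid.
under eq_integral do rewrite EFinN.
rewrite integralN/=; last by apply: integrable_add_def.
have := integrable_fin_num _ Nint => /(_ measurableT) /=.
case: (integral _ _ _) => //= r _ [h]; congr EFin; lra.
Qed.

(** X has the law of m + s xi with xi standard normal, tested on continuous functions. The case s =
    0 covers point masses, so both branches of [gaussian_law] are treated alike from here on. *)
Definition affine_normal d (T : measurableType d) (P : probability T R) (X : T -> R) m s :=
  forall f : R -> R, continuous f ->
    (\int[P]_w (f (X w))%:E = \int[N]_x (f (m + s * x))%:E)%E.

Lemma gaussian_law_affine_normal d (T : measurableType d) (P : probability T R) (X : T -> R) :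
  measurable_fun setT X -> gaussian_law (pushforward P X) ->
  exists m s, 0 <= s /\ affine_normal P X m s.
Proof.
move=> mX [m [s [s0 HP]]]; exists m, s; split => // f cf.
have mX' : measurable_fun setT (X : T -> measurableTypeR R) := mX.
(* The same function is packed with two codomains: [measurableTypeR R] for the normal law and [R]
   for the Dirac mass. *)
pose Y : {mfun T >-> measurableTypeR R} :=
  HB.pack X (isMeasurableFun.Build _ _ T (measurableTypeR R) X mX').
pose Y0 : {mfun T >-> R} := HB.pack X (isMeasurableFun.Build _ _ T R X mX).
move: f cf; apply: (@integral_ge0_ext _ _ _ _ _ P N X (fun x => m + s * x)) => f cf f0.
have mf := continuous_measurable_fun cf.
have [s_eq0|s_neq0] := eqVneq s 0; last first.
  transitivity (\int[distribution P Y]_x (f x)%:E)%E.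
    by rewrite ge0_integral_distribution//; exact/measurable_EFinP.
  transitivity (\int[normal_prob m s]_x (f x)%:E)%E.
    apply: eq_measure_integral => A mA _.
    by rewrite -[LHS]/(pushforward P X A) HP// (negbTE s_neq0).
  by rewrite integral_normal_affine// lt_neqAle eq_sym s_neq0.
transitivity (\int[distribution P Y0]_x (f x)%:E)%E.
  by rewrite ge0_integral_distribution//; exact/measurable_EFinP.
transitivity (\int[\d_m]_x (f x)%:E)%E.
  apply: eq_measure_integral => A mA _.
  by rewrite -[LHS]/(pushforward P X A) HP// s_eq0 eqxx.
rewrite integral_dirac// ?diracT ?mul1e; last exact/measurable_EFinP.
transitivity (\int[N]_(x in setT) (cst (f m)%:E) x)%E; last first.
  by apply: eq_integral => x _; rewrite s_eq0 mul0r addr0.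
rewrite integral_cst//= -[LHS]mule1; congr (_ * _)%E.
by apply: esym; exact: probability_setT.
Qed.

Lemma normal_integrable_id : N.-integrable setT (EFin \o (fun x : R => x)).
Proof.
apply/Lfun1_integrable; apply: Lfun_subset12; first by apply: fin_num_measure.
apply: Lfun2P; last exact: integral_sqr_fin.
by apply: continuous_measurable_fun => x; exact: cvg_id.
Qed.

Lemma normal_integrable_sqr : N.-integrable setT (EFin \o (fun x : R => x ^+ 2)).
Proof.
apply: Lfun2_integrable_sqr; apply: Lfun2P; last exact: integral_sqr_fin.
by apply: continuous_measurable_fun => x; exact: cvg_id.
Qed.

Section affine_normal.
Context d (T : measurableType d) (P : probability T R) (X : T -> R) (m s : R).
Hypotheses (mX : measurable_fun setT X) (XN : affine_normal P X m s).

Lemma affine_normal_sqr a :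
  (\int[P]_w ((X w - a) ^+ 2)%:E = ((m - a) ^+ 2 + s ^+ 2 * normal_sqr)%:E)%E.
Proof.
rewrite (XN (f := fun x => (x - a) ^+ 2)); last first.
  move=> x; apply: (@continuous_comp _ _ _ (fun x => x - a) (fun x => x ^+ 2)).
    by apply: continuousB; [exact: cvg_id|exact: cst_continuous].
  exact: continuous_sqr.
have i1 : N.-integrable setT (fun x : R => (2 * (m - a) * s)%:E * x%:E)%E.
  by apply: integrableZl => //; exact: normal_integrable_id.
have i2 : N.-integrable setT (fun x : R => (s ^+ 2)%:E * (x ^+ 2)%:E)%E.
  by apply: integrableZl => //; exact: normal_integrable_sqr.
have i0 : N.-integrable setT (fun x : R => ((m - a) ^+ 2)%:E).
  by apply/finite_measure_integrable_cst.
transitivity (\int[N]_x (((m - a) ^+ 2)%:E + ((2 * (m - a) * s)%:E * x%:E + (s ^+ 2)%:E * (x ^+ 2)%:E)))%E.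
  by apply: eq_integral => x _; rewrite -!EFinM -!EFinD; congr EFin; ring.
rewrite integralD//=; last exact: integrableD.
rewrite integralD//= integralZl//=; last exact: normal_integrable_id.
rewrite integralZl//=; last exact: normal_integrable_sqr.
rewrite integral_normal_id mule0 add0e integral_normal_sqr integral_cst//=.
rewrite EFinD EFinM; congr (_ + _)%E; rewrite -[RHS]mule1; congr (_ * _)%E.
exact: probability_setT.
Qed.

Lemma affine_normal_Lfun2 : X \in Lfun P 2%:E.
Proof.
apply: Lfun2P => //; have := affine_normal_sqr 0.
by under eq_integral do rewrite subr0; move=> ->; rewrite ltry.
Qed.

Lemma affine_normal_expectation : ('E_P[X] = m%:E)%E.
Proof.
rewrite unlock (XN (f := id)); last by move=> x; exact: cvg_id.
under eq_integral do rewrite EFinD EFinM.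
rewrite integralD//=.
- rewrite integralZl//=; last exact: normal_integrable_id.
  rewrite integral_normal_id mule0 adde0 integral_cst//= -[RHS]mule1; congr (_ * _)%E.
  exact: probability_setT.
- by apply/finite_measure_integrable_cst.
- by apply: integrableZl => //; exact: normal_integrable_id.
Qed.

Lemma affine_normal_variance : (variance P X = (s ^+ 2 * normal_sqr)%:E)%E.
Proof.
rewrite /variance unlock affine_normal_expectation unlock /=.
transitivity (\int[P]_w ((X w - m) ^+ 2)%:E)%E.
  by apply: eq_integral => w _; rewrite expr2.
by rewrite affine_normal_sqr subrr expr0n/= add0r.
Qed.

End affine_normal.

(** The characteristic function of the standard normal law, real by symmetry. Its closed form is
    replaced by the functional equation [normal_cosM]. *)
Definition normal_cos (t : R) : R := \int[N]_x cos (t * x).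

Lemma normal_cos_affine b t : \int[N]_x cos (b + t * x) = cos b * normal_cos t.
Proof.
have mlin : measurable_fun setT (fun x : R => t * x).
  by apply: continuous_measurable_fun; exact: mulrl_continuous.
have ic : N.-integrable setT (EFin \o (fun x : R => cos (t * x))) by exact: cos_integrable.
have csin : continuous (fun x : R => sin (t * x)).
  move=> x; apply: (@continuous_comp _ _ _ (fun x : R => t * x) sin).
    exact: mulrl_continuous.
  exact: continuous_sin.
have is_ : N.-integrable setT (EFin \o (fun x : R => sin (t * x))).
  apply: (@bounded_integrable _ _ _ _ _ 1); first exact: continuous_measurable_fun.
  by move=> x; rewrite ler_norml sin_geN1 sin_le1.
have sin0 : \int[N]_x sin (t * x) = 0.
  have : \int[N]_x sin (t * x) = - \int[N]_x sin (t * x).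
    rewrite -mulN1r -RintegralZl// /Rintegral -[in LHS](integral_normal_opp csin).
    by congr fine; apply: eq_integral => x _; rewrite mulrN sinN mulN1r.
  by lra.
under eq_Rintegral do rewrite cosD.
rewrite RintegralB//=; last 2 first.
- exact: (integrableZl _ (cos b) ic).
- exact: (integrableZl _ (sin b) is_).
by rewrite !RintegralZl// sin0 mulr0 subr0.
Qed.

Lemma affine_normal_cos d (T : measurableType d) (P : probability T R) (X : T -> R) m s b :
  affine_normal P X m s ->
  \int[P]_w cos (X w + b) = cos (m + b) * normal_cos s.
Proof.
move=> XN; rewrite -normal_cos_affine /Rintegral; congr fine.
have -> : (fun x => (cos (m + b + s * x))%:E) = (fun x => (cos (m + s * x + b))%:E).
  by apply/funext => x; rewrite addrAC.
apply: (XN (fun x => cos (x + b))) => x.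
apply: (@continuous_comp _ _ _ (fun x : R => x + b) cos); last exact: continuous_cos.
by apply: continuousD; [exact: cvg_id|exact: cst_continuous].
Qed.

Lemma normal_cos0 : normal_cos 0 = 1.
Proof.
rewrite /normal_cos; under eq_Rintegral do rewrite mul0r cos0.
by rewrite Rintegral_cst//= probability_setT mulr1.
Qed.

Lemma normal_cosN t : normal_cos (- t) = normal_cos t.
Proof. by rewrite /normal_cos; apply: eq_Rintegral => x _; rewrite mulNr cosN. Qed.

End normal_moments.

(** * Functional equation of the cosine transform *)

Section normal_cos_mul.
Context (R : realType).
Local Notation N := (normal_prob (0 : R) 1).
Local Notation mu := (@lebesgue_measure R).

Lemma normal_peakE (s : R) : 0 < s -> normal_peak s = normal_peak 1 / s.
Proof.
have E (x : R) : 0 < x -> normal_peak x = (x * Num.sqrt (pi *+ 2))^-1.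
  move=> x0; rewrite /normal_peak -mulrnAr sqrtrM ?sqr_ge0// sqrtr_sqr.
  by rewrite (gtr0_norm x0).
by move=> s0; rewrite !E// mul1r invfM mulrC.
Qed.

(* The density of the sum of independent N(0, t^2) and N(0, s^2) variables, by
   completion of the square. *)
Lemma normal_pdf_convolution (s t u y : R) : 0 < s ->
  let r := Num.sqrt (s ^+ 2 + t ^+ 2) in
  normal_pdf (t * y) s u * normal_pdf 0 1 y =
  normal_pdf 0 r u * normal_pdf (u * t / r ^+ 2) (s / r) y.
Proof.
move=> s0 r.
have q0 : 0 < s ^+ 2 + t ^+ 2 by rewrite ltr_wpDr ?sqr_ge0 ?exprn_gt0.
have r0 : 0 < r by rewrite sqrtr_gt0.
have r2 : r ^+ 2 = s ^+ 2 + t ^+ 2 by rewrite sqr_sqrtr// ltW.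
have sr0 : 0 < s / r by rewrite divr_gt0.
rewrite !normal_pdfE ?gt_eqF//= /normal_fun.
rewrite (normal_peakE s0) (normal_peakE r0) (normal_peakE sr0).
rewrite mulrACA [RHS]mulrACA -!expRD; congr (_ * expR _).
  by field; rewrite !gt_eqF.
rewrite expr_div_n r2 subr0 expr1n.
by field; rewrite !gt_eqF.
Qed.

(** Let X and Y be independent standard normal. The double integral of [g] tests 1 + cos(u) against
    the joint density of u = s X + t Y and Y. Integrating over Y first gives u the law N(0, r^2);
    integrating over u first produces the product. The summand 1 makes the integrand nonnegative, so
    Tonelli applies directly. *)
Lemma normal_cosM_gt0 s t : 0 < s ->
  normal_cos s * normal_cos t = normal_cos (Num.sqrt (s ^+ 2 + t ^+ 2)) :> R.
Proof.
move=> s0; set r := Num.sqrt _.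
have q0 : 0 < s ^+ 2 + t ^+ 2 by rewrite ltr_wpDr ?sqr_ge0 ?exprn_gt0.
have r0 : 0 < r by rewrite sqrtr_gt0.
have cosint (a e b : R) :
    (\int[N]_x (1 + a * cos (e + b * x))%:E = (1 + a * (cos e * normal_cos b))%:E)%E.
  have mlin : measurable_fun setT (fun x : R => e + b * x).
    by apply: continuous_measurable_fun; exact: continuous_affine.
  have ic : N.-integrable setT (EFin \o (fun x : R => cos (e + b * x))) by exact: cos_integrable.
  under eq_integral do rewrite EFinD EFinM.
  rewrite integralD//=; last 2 first.
  - exact: finite_measure_integrable_cst.
  - exact: integrableZl.
  rewrite integralZl// EFinD EFinM; congr (_ + _ * _)%E.
    by rewrite integral_cst//= mul1e; exact: probability_setT.
  by rewrite -normal_cos_affine /Rintegral fineK//; exact: integrable_fin_num.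
pose f (x : R) := 1 + cos x.
have cf : continuous f.
  by move=> x; apply: continuousD; [exact: cst_continuous|exact: continuous_cos].
have mf := continuous_measurable_fun cf.
have f0 (x : R) : 0 <= f x by have := cos_geN1 x; rewrite /f; lra.
have fint e b : (\int[N]_x (f (e + b * x))%:E = (1 + cos e * normal_cos b)%:E)%E.
  by rewrite -[in RHS](mul1r (cos e * _)) -cosint; under [RHS]eq_integral do rewrite mul1r.
(* Obtained from the nonnegative functions 1 + cos and 1 - cos; it makes 1 + [normal_cos s] cos(t x)
   nonnegative in the second order of integration. *)
have cos_norm (b : R) : `|normal_cos b| <= 1.
  have h1 := fint 0 b; have h2 := cosint (-1) 0 b; rewrite cos0 mul1r in h1 h2.
  have : (0 <= (1 + normal_cos b)%:E)%E.
    by rewrite -h1; apply: integral_ge0 => x _; rewrite lee_fin.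
  have : (0 <= (1 + -1 * normal_cos b)%:E)%E.
    rewrite -h2; apply: integral_ge0 => x _; rewrite lee_fin.
    by have := cos_le1 (0 + b * x); lra.
  by rewrite !lee_fin ler_norml => ? ?; apply/andP; split; lra.
pose g (z : R * R) : \bar R :=
  (f z.1 * (normal_pdf 0 s (z.1 - t * z.2) * normal_pdf 0 1 z.2))%:E.
have mg : measurable_fun setT g.
  apply/measurable_EFinP; apply: measurable_funM.
    exact: measurableT_comp mf measurable_fst.
  apply: measurable_funM; last exact: measurableT_comp (measurable_normal_pdf 0 1) measurable_snd.
  apply: (measurableT_comp (measurable_normal_pdf 0 s)).
  apply: measurable_funB; first exact: measurable_fst.
  by apply: measurable_funM => //; exact: measurable_snd.
have g0 z : (0 <= g z)%E by rewrite lee_fin mulr_ge0 ?f0// mulr_ge0 ?normal_pdf_ge0.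
have shift y u : normal_pdf 0 s (u - t * y) = normal_pdf (t * y) s u.
  by rewrite !normal_pdfE ?gt_eqF//= /normal_fun subr0.
have L : (\int[mu]_u \int[mu]_y g (u, y) = (1 + normal_cos r)%:E)%E.
  transitivity (\int[normal_prob 0 r]_u (f u)%:E)%E.
    rewrite ge0_integral_normal//.
    apply: eq_integral => u _; rewrite /g.
    transitivity (\int[mu]_y ((f u * normal_pdf 0 r u)%:E *
        (normal_pdf (u * t / r ^+ 2) (s / r) y)%:E))%E.
      apply: eq_integral => y _; rewrite -EFinM; congr EFin.
      by rewrite [(_, _).1]/= [(_, _).2]/= shift normal_pdf_convolution// mulrA.
    rewrite ge0_integralZl//= ?integral_normal_pdf ?mule1//.
    - by apply/measurable_EFinP; exact: measurable_normal_pdf.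
    - by move=> y _; rewrite lee_fin normal_pdf_ge0.
    - by rewrite lee_fin mulr_ge0 ?f0 ?normal_pdf_ge0.
  by rewrite integral_normal_affine// fint cos0 mul1r.
have RR : (\int[mu]_y \int[mu]_u g (u, y) = (1 + normal_cos s * normal_cos t)%:E)%E.
  have := cosint (normal_cos s) 0 t; rewrite cos0 mul1r => <-; rewrite ge0_integral_normal; last 2 first.
  - apply: measurable_funD => //; apply: measurable_funM => //.
    apply: measurable_cos_comp.
    by apply: continuous_measurable_fun; exact: continuous_affine.
  - move=> x; have := cos_norm s.
    have : `|cos (0 + t * x)| <= 1 by rewrite ler_norml cos_geN1 cos_le1.
    set a := cos _; set b := normal_cos s => a1 b1.
    have : `|b * a| <= 1 by rewrite normrM mulr_ile1.
    by rewrite ler_norml => /andP[h _]; lra.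
  apply: eq_integral => y _; rewrite /g.
  transitivity (\int[mu]_u ((f u * normal_pdf (t * y) s u)%:E *
       (normal_pdf 0 1 y)%:E))%E.
    apply: eq_integral => u _; rewrite -EFinM; congr EFin.
    by rewrite [(_, _).1]/= [(_, _).2]/= shift mulrA.
  rewrite ge0_integralZr//=; last 3 first.
  - by apply/measurable_EFinP/measurable_funM => //; exact: measurable_normal_pdf.
  - by move=> u _; rewrite lee_fin mulr_ge0 ?f0 ?normal_pdf_ge0.
  - by rewrite lee_fin normal_pdf_ge0.
  rewrite EFinM; congr (_ * _)%E.
  rewrite -ge0_integral_normal// integral_normal_affine// fint.
  by rewrite add0r mulrC.
have := @fubini_tonelli _ _ _ _ _ mu mu g mg g0.
by rewrite L RR => -[]; lra.
Qed.

Lemma normal_cosM s t :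
  normal_cos s * normal_cos t = normal_cos (Num.sqrt (s ^+ 2 + t ^+ 2)) :> R.
Proof.
have [s0|s0|->] := ltgtP s 0; last 2 first.
- exact: normal_cosM_gt0.
- rewrite normal_cos0 mul1r expr0n/= add0r sqrtr_sqr.
  by case: ger0P; rewrite ?normal_cosN.
- by rewrite -normal_cosN normal_cosM_gt0 ?oppr_gt0// sqrrN.
Qed.

End normal_cos_mul.

(** * Uniqueness from trigonometric integrals *)

Section step_approximation.
Context (R : realType).

Lemma bernoulli_ge (x : R) n : 0 <= x -> 1 + n%:R * x <= (1 + x) ^+ n.
Proof.
move=> x0; elim: n => [|n IH]; first by rewrite mul0r addr0 expr0.
rewrite exprS; apply: (@le_trans _ _ ((1 + x) * (1 + n%:R * x))).
  by rewrite -natr1; have := mulr_ge0 (ler0n R n) (mulr_ge0 x0 x0); lra.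
by rewrite ler_wpM2l// addr_ge0.
Qed.

Lemma bernoulli_le (x : R) n : 0 <= x <= 1 -> 1 - n%:R * x <= (1 - x) ^+ n.
Proof.
move=> /andP[x0 x1]; elim: n => [|n IH]; first by rewrite mul0r subr0 expr0.
rewrite exprS; apply: (@le_trans _ _ ((1 - x) * (1 - n%:R * x))).
  by rewrite -natr1; have := mulr_ge0 (ler0n R n) (mulr_ge0 x0 x0); lra.
by rewrite ler_wpM2l// subr_ge0.
Qed.

(** With z = sqrt x, Bernoulli's inequality for 1/z bounds n z^n by a constant C, so n x^n <= C
    z^n. *)
Lemma cvg_natM_expr (x : R) : 0 <= x < 1 -> (fun n => n%:R * x ^+ n) @ \oo --> (0 : R).
Proof.
move=> /andP[x0 x1].
have [->|x_neq0] := eqVneq x 0.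
  rewrite (_ : (fun n => _) = cst 0); first exact: cvg_cst.
  by apply/funext => -[|n]; rewrite ?mul0r// exprS mul0r mulr0.
have xgt0 : 0 < x by rewrite lt_neqAle eq_sym x_neq0.
pose z := Num.sqrt x.
have z0 : 0 < z by rewrite sqrtr_gt0.
have z1 : z < 1 by rewrite -sqrtr1 ltr_sqrt.
have z2 : x = z * z by rewrite -expr2 sqr_sqrtr.
pose C := (z^-1 - 1)^-1.
have C0 : 0 < z^-1 - 1 by rewrite subr_gt0 invf_gt1.
have nz n : n%:R * z ^+ n <= C.
  rewrite -ler_pdivlMr ?exprn_gt0// -exprVn /C mulrC ler_pdivlMr//.
  by have := bernoulli_ge n (ltW C0); rewrite (addrC 1 (_ - 1)) subrK; lra.
have C1 : (fun n => C * z ^+ n) @ \oo --> (0 : R).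
  by apply: (@cvg_geometric R C z); rewrite ger0_norm ?(ltW z0).
apply: (@squeeze_cvgr _ _ _ _ (cst 0) (fun n => C * z ^+ n)) => //; last exact: cvg_cst.
apply: nearW => n; rewrite mulr_ge0 ?exprn_ge0//= z2 exprMn mulrA.
by rewrite ler_wpM2r// exprn_ge0// ltW.
Qed.

(** A variant of the polynomials in the Brosowski-Deutsch proof of the Stone-Weierstrass theorem.
    The 2^n puts the threshold at y = 1/2; the extra factor n forces the limit 0 at the threshold
    itself, where the exponent 2^n alone would give 1/e. *)
Definition step_poly (n : nat) (y : R) : R := (1 - y ^+ n) ^+ (n * 2 ^ n).

Lemma step_poly_itv n y : 0 <= y <= 1 -> 0 <= step_poly n y <= 1.
Proof.
move=> /andP[y0 y1]; have yn0 : 0 <= y ^+ n by rewrite exprn_ge0.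
have yn1 : y ^+ n <= 1 by rewrite exprn_ile1.
by rewrite exprn_ge0 ?subr_ge0//= exprn_ile1 ?subr_ge0// gerBl.
Qed.

(* With z = y^n and m = n 2^n one has (1-z)^m >= 1 - m z = 1 - n (2y)^n and
   (1-z)^m <= 1 / (1 + m z) <= 1 / (1 + n (2y)^n). *)
Lemma cvg_step_poly (y : R) : 0 <= y <= 1 ->
  (fun n => step_poly n y) @ \oo --> ((y < 1 / 2)%R%:R : R).
Proof.
move=> y01; have /andP[y0 y1] := y01.
have yn (n : nat) : 0 <= y ^+ n <= 1 by rewrite exprn_ge0//= exprn_ile1.
have mE (n : nat) : (n * 2 ^ n)%:R * y ^+ n = n%:R * (2 * y) ^+ n :> R.
  by rewrite natrM natrX -mulrA -exprMn.
case: (ltP y (1 / 2)) => y2 /=.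
  apply: (@squeeze_cvgr _ _ _ _ (fun n => 1 - n%:R * (2 * y) ^+ n) (cst 1)) => //.
  - apply: nearW => n; have /andP[_ ->] := step_poly_itv n y01; rewrite andbT -mE.
    exact: bernoulli_le.
  - rewrite -[X in _ --> X]subr0; apply: cvgB; first exact: cvg_cst.
    by apply: cvg_natM_expr; apply/andP; split; lra.
  - exact: cvg_cst.
apply: (@squeeze_cvgr _ _ _ _ (cst 0) (@harmonic R)) => //.
- apply: nearW => n; have /andP[-> _] := step_poly_itv n y01; rewrite /=.
  have /andP[yn0 yn1] := yn n.
  have h : n.+1%:R <= (1 + y ^+ n) ^+ (n * 2 ^ n).
    apply: le_trans (bernoulli_ge _ yn0); rewrite mE -natr1 addrC lerD2l.
    by rewrite ler_peMr// exprn_ege1//; lra.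
  rewrite -[leRHS]mul1r ler_pdivlMr//.
  apply: (@le_trans _ _ (step_poly n y * (1 + y ^+ n) ^+ (n * 2 ^ n))).
    by rewrite ler_wpM2l// exprn_ge0// subr_ge0.
  rewrite /step_poly -exprMn exprn_ile1//.
    by rewrite mulr_ge0 ?subr_ge0// addr_ge0.
  by have := mulr_ge0 yn0 yn0; lra.
- exact: cvg_cst.
- exact: cvg_harmonic.
Qed.

End step_approximation.

Section trig_functions.
Context (R : realType).

(** Real trigonometric polynomials with arbitrary real frequencies; the phase b accounts for sines.
    Product-to-sum formulas make them an algebra, so polynomials may be applied to them. *)
Inductive trig : (R -> R) -> Prop :=
| trig_cos s b : trig (fun x => cos (s * x + b))
| trig_scale c u : trig u -> trig (fun x => c * u x)
| trig_add u v : trig u -> trig v -> trig (fun x => u x + v x).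

Lemma trig_ext u v : u =1 v -> trig u -> trig v.
Proof. by move=> /funext ->. Qed.

Lemma trig_cst c : trig (fun=> c).
Proof.
apply: (trig_ext _ (trig_scale c (trig_cos 0 0))) => x.
by rewrite mul0r addr0 cos0 mulr1.
Qed.

Lemma trig_mul u v : trig u -> trig v -> trig (fun x => u x * v x).
Proof.
move=> tu tv; elim: tu => [s b|c {}u _ IH|u1 u2 _ IH1 _ IH2]; last 2 first.
- by apply: (trig_ext _ (trig_scale c IH)) => x; rewrite mulrA.
- by apply: (trig_ext _ (trig_add IH1 IH2)) => x; rewrite mulrDl.
elim: tv => [t e|c {}v _ IH|v1 v2 _ IH1 _ IH2]; last 2 first.
- by apply: (trig_ext _ (trig_scale c IH)) => x; rewrite mulrCA.
- by apply: (trig_ext _ (trig_add IH1 IH2)) => x; rewrite mulrDr.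
apply: (trig_ext _ (trig_add (trig_scale (1 / 2) (trig_cos (s + t) (b + e)))
  (trig_scale (1 / 2) (trig_cos (s - t) (b - e))))) => x.
rewrite (_ : (s + t) * x + (b + e) = (s * x + b) + (t * x + e)); last by ring.
rewrite (_ : (s - t) * x + (b - e) = (s * x + b) - (t * x + e)); last by ring.
by rewrite cosD cosB; field.
Qed.

Lemma trig_exp u n : trig u -> trig (fun x => u x ^+ n).
Proof.
move=> tu; elim: n => [|n IH]; first exact: trig_cst.
by apply: (trig_ext _ (trig_mul tu IH)) => x; rewrite exprS.
Qed.

Lemma trig_step_poly u n : trig u -> trig (fun x => step_poly n (u x)).
Proof.
move=> tu; apply: trig_exp.
apply: (trig_ext _ (trig_add (trig_cst 1) (trig_scale (-1) (trig_exp n tu)))) => x.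
by rewrite mulN1r.
Qed.

Lemma trig_sin d a : trig (fun x => (1 - sin (d * (x - a))) / 2).
Proof.
apply: (trig_ext _ (trig_add (trig_cst (1 / 2))
   (trig_scale (1 / 2) (trig_cos d (- (d * a) + pi / 2))))) => x.
by rewrite addrA -mulrBr cosDpihalf; field.
Qed.

Lemma trig_continuous u : trig u -> continuous u.
Proof.
elim=> [s b|c {}u _ IH|u1 u2 _ IH1 _ IH2] x.
- apply: (@continuous_comp _ _ _ (fun x => s * x + b) cos); last exact: continuous_cos.
  by apply: continuousD; [exact: mulrl_continuous|exact: cst_continuous].
- by apply: continuousM; [exact: cst_continuous|exact: IH].
- by apply: continuousD; [exact: IH1|exact: IH2].
Qed.

End trig_functions.

Section trig_uniqueness.
Context d (T : measurableType d) (R : realType).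
Context (P : {finite_measure set T -> \bar R}) (nu : probability (measurableTypeR R) R).
Variables (xi W : T -> R) (kappa B : R).
Hypotheses (mxi : measurable_fun setT xi) (mW : measurable_fun setT W).
Hypothesis WB : forall w, `|W w| <= B.
Implicit Types u v : R -> R.

(** The test functions for which the weight W factors out of the integral, an independence statement
    when [nu] is the normalized law of [xi]. The class is enlarged from cosines to square waves,
    half-lines and finally Borel sets, by bounded limits and a Dynkin argument. *)
Let good (u : R -> R) : Prop := [/\ measurable_fun setT u, exists M : R, forall x, `|u x| <= M &
  \int[P]_w (u (xi w) * W w) = kappa * \int[nu]_x u x].

Let integrableP_comp u (M : R) : measurable_fun setT u -> (forall x, `|u x| <= M) ->
  P.-integrable setT (EFin \o (fun w => u (xi w) * W w)).
Proof.
move=> mu uM; apply: (@bounded_integrable _ _ _ _ _ (M * B)).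
  by apply: measurable_funM => //; exact: measurableT_comp.
by move=> w; rewrite normrM ler_pM.
Qed.

Let integrablenu u (M : R) : measurable_fun setT u -> (forall x, `|u x| <= M) ->
  nu.-integrable setT (EFin \o u).
Proof. by move=> mu uM; apply: (@bounded_integrable _ _ _ _ _ M). Qed.

Let good_scale c u : good u -> good (fun x => c * u x).
Proof.
move=> [mu [M uM] E]; split.
- exact: measurable_funM.
- by exists (`|c| * M) => x; rewrite normrM ler_wpM2l.
rewrite [RHS](_ : _ = kappa * (c * \int[nu]_x u x)).
  rewrite mulrCA -E -RintegralZl//; last exact: integrableP_comp uM.
  by apply: eq_Rintegral => w _; rewrite mulrA.
by rewrite RintegralZl//; exact: integrablenu uM.
Qed.

Let good_add u v : good u -> good v -> good (fun x => u x + v x).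
Proof.
move=> [mu [M uM] Eu] [mv [M' vM] Ev]; split.
- exact: measurable_funD.
- by exists (M + M') => x; rewrite (le_trans (ler_normD _ _))// lerD.
rewrite RintegralD//; [|exact: integrablenu uM|exact: integrablenu vM].
rewrite mulrDr -Eu -Ev -RintegralD//;
  [|exact: integrableP_comp uM|exact: integrableP_comp vM].
by apply: eq_Rintegral => w _; rewrite mulrDl.
Qed.

Let Rintegral_bounded_cvg d' (T' : measurableType d') (Q : {finite_measure set T' -> \bar R})
    (f_ : nat -> T' -> R) (f : T' -> R) (M : R) :
  (forall n, measurable_fun setT (f_ n)) -> measurable_fun setT f ->
  (forall n x, `|f_ n x| <= M) -> (forall x, (fun n => f_ n x) @ \oo --> f x) ->
  (fun n => \int[Q]_x f_ n x) @ \oo --> \int[Q]_x f x.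
Proof.
move=> mf_ mf fM ff; apply: fine_cvg.
have fM' x : `|f x| <= M.
  have h : (fun n => `|f_ n x|) @ \oo --> `|f x| by apply: cvg_norm.
  rewrite -(cvg_lim _ h)//; apply: limr_le; first by apply/cvg_ex; exists `|f x|.
  by apply: nearW => n; exact: fM.
rewrite fineK; last by apply: integrable_fin_num => //; exact: bounded_integrable fM'.
apply: (@dominated_cvg _ _ _ _ _ measurableT _ _ (fun=> M%:E)).
- by move=> n; exact/measurable_EFinP.
- by move=> x _; apply: cvg_EFin; [exact: nearW|exact: ff].
- by [].
- exact: finite_measure_integrable_cst.
- by move=> n x _; rewrite lee_fin.
Qed.

Let good_lim (u_ : nat -> R -> R) u (M : R) : (forall n, good (u_ n)) ->
  (forall n x, `|u_ n x| <= M) -> (forall x, (fun n => u_ n x) @ \oo --> u x) -> good u.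
Proof.
move=> gu uM uu.
have mu_ n : measurable_fun setT (u_ n) by have [] := gu n.
have mu : measurable_fun setT u.
  by apply: (measurable_fun_cvg (h := u_)) => // x _; exact: uu.
have uM' x : `|u x| <= M.
  have h : (fun n => `|u_ n x|) @ \oo --> `|u x| by apply: cvg_norm.
  rewrite -(cvg_lim _ h)//; apply: limr_le; first by apply/cvg_ex; exists `|u x|.
  by apply: nearW => n; exact: uM.
split => //; first by exists M.
have h1 : (fun n => \int[P]_w (u_ n (xi w) * W w)) @ \oo --> \int[P]_w (u (xi w) * W w).
  apply: (@Rintegral_bounded_cvg _ _ _ _ _ (M * B)).
  - by move=> n; apply: measurable_funM => //; exact: measurableT_comp.
  - by apply: measurable_funM => //; exact: measurableT_comp.
  - by move=> n x; rewrite normrM ler_pM.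
  - by move=> w; apply: cvgM; [exact: uu|exact: cvg_cst].
have h2 : (fun n => kappa * \int[nu]_x u_ n x) @ \oo --> kappa * \int[nu]_x u x.
  apply: cvgM; first exact: cvg_cst.
  exact: (@Rintegral_bounded_cvg _ _ _ _ _ M).
have E : (fun n => \int[P]_w (u_ n (xi w) * W w)) = (fun n => kappa * \int[nu]_x u_ n x).
  by apply/funext => n; have [] := gu n.
by rewrite E in h1; exact: (cvg_unique _ h1 h2).
Qed.

Hypothesis xiN : forall s b : R, \int[P]_w (cos (s * xi w + b) * W w) =
  kappa * \int[nu]_x cos (s * x + b).

Let good_trig u : trig u -> good u.
Proof.
elim=> [s b|c {}u _ IH|u1 u2 _ IH1 _ IH2]; [|exact: good_scale|exact: good_add].
split; last exact: xiN.
- by apply: continuous_measurable_fun; apply: trig_continuous; exact: trig_cos.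
- by exists 1 => x; rewrite ler_norml cos_geN1 cos_le1.
Qed.

Let good_sin dl a : good (fun x => (0 < sin (dl * (x - a)))%R%:R).
Proof.
(* This maps into [0, 1] and lies below the threshold 1/2 exactly where the sine is positive. *)
pose y x := (1 - sin (dl * (x - a))) / 2.
have y01 x : 0 <= y x <= 1.
  by have := sin_geN1 (dl * (x - a)); have := sin_le1 (dl * (x - a));
    move=> ? ?; apply/andP; split; rewrite /y; lra.
apply: (good_lim (u_ := fun n x => step_poly n (y x)) (M := 1)).
- by move=> n; apply: good_trig; apply: trig_step_poly; exact: trig_sin.
- by move=> n x; have /andP[h0 h1] := step_poly_itv n (y01 x); rewrite ger0_norm.
- move=> x; rewrite (_ : (0 < sin _) = (y x < 1 / 2)); first exact: cvg_step_poly.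
  by rewrite /y; apply/idP/idP => h; lra.
Qed.

(** Square waves starting at a, with half-period (n + 1) pi. For fixed x the half-period eventually
    exceeds |x - a|, and the wave then agrees at x with the indicator of the half-line; at x = a
    both are 0. *)
Let good_ray a : good \1_`]a, +oo[.
Proof.
apply: (good_lim (u_ := fun n x => (0 < sin (n.+1%:R^-1 * (x - a)))%R%:R) (M := 1)).
- by move=> n; exact: good_sin.
- by move=> n x; case: (_ < _); rewrite ?normr1 ?normr0.
move=> x; rewrite indicE.
have -> : (x \in `]a, +oo[%classic) = (a < x).
  by apply/idP/idP; rewrite inE/= in_itv/= andbT.
have [->|xa] := eqVneq x a.
  rewrite ltxx; under eq_fun do rewrite subrr mulr0 sin0 ltxx.
  exact: cvg_cst.
apply: cvg_near_cst.
have xa0 : 0 < `|x - a| by rewrite normr_gt0 subr_eq0.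
have e0 : 0 < pi / `|x - a| by rewrite divr_gt0 ?pi_gt0.
near=> n.
have nlt : n.+1%:R^-1 < pi / `|x - a|.
  by near: n; exact: (near_infty_natSinv_lt (PosNum e0)).
have n0 : 0 < n.+1%:R^-1 :> R by rewrite invr_gt0.
rewrite ltr_pdivlMr// in nlt.
congr (nat_of_bool _)%:R; move: xa; rewrite neq_lt => /orP[xa|ax].
  rewrite [RHS]ltNge (ltW xa)/=; apply/negbTE; rewrite -leNgt.
  rewrite -[x - a]opprB mulrN sinN oppr_le0 sin_ge0_pi//.
  by rewrite ltr0_norm ?subr_lt0// opprB in nlt; rewrite mulr_ge0 ?(ltW n0) ?subr_ge0 ?(ltW xa)// ltW.
rewrite [RHS]ax; apply: sin_gt0_pi.
by rewrite gtr0_norm ?subr_gt0// in nlt; rewrite mulr_gt0 ?subr_gt0.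
Unshelve. all: by end_near. Qed.

Let good_indic A : measurable A -> good \1_A.
Proof.
have E := RGenOInfty.measurableE R.
move=> mA; apply: (@dynkin_induction _ (measurableTypeR R) (@RGenOInfty.G R)
   [set A | good \1_A]) => //.
- move=> _ _ [a ->] [b ->]; exists (Num.max a b).
  by apply/seteqP; split=> x /=; rewrite !in_itv/= !andbT gt_max;
    [move=> [-> ->]|move=> /andP[]].
- rewrite /= (_ : \1__ = (fun=> 1)); first by apply: good_trig; exact: trig_cst.
  by apply/funext => x; rewrite indicE in_setT.
- by move=> _ [a ->]; exact: good_ray.
- move=> S mS gS /=.
  have := good_add (good_trig (trig_cst 1)) (good_scale (-1) gS).
  rewrite (_ : (fun x => 1 + -1 * \1_S x) = \1_(~` S))//.
  by apply/funext => x; rewrite !indicE in_setC; case: (x \in S) => /=; lra.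
- move=> F mF tF gF /=.
  (* By disjointness a point of the union lies in a single [F k], so the partial sums of indicators
     jump once from 0 to 1 and stay bounded by 1. *)
  have sumE x : (\bigcup_k F k) x ->
      exists k : nat, forall n : nat, \sum_(i < n) \1_(F i) x = (k < n)%N%:R :> R.
    move=> [k _ Fkx]; exists k => n.
    have FE (i : nat) : \1_(F i) x = (i == k)%:R :> R.
      rewrite indicE; congr (nat_of_bool _)%:R; apply/idP/eqP => [|->]; last by rewrite inE.
      by rewrite inE => Fix; apply: (tF i k I I); exists x.
    have [kn|nk] := ltnP k n.
      rewrite (bigD1 (Ordinal kn))//= FE eqxx big1 ?addr0// => i /negbTE ik.
      by rewrite FE -val_eqE/= in ik *; rewrite ik.
    by apply: big1 => i _; rewrite FE ltn_eqF// (leq_trans (ltn_ord i)).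
  have sum0 x : ~ (\bigcup_k F k) x -> forall n : nat, \sum_(i < n) \1_(F i) x = 0 :> R.
    move=> nx n; apply: big1 => i _; rewrite indicE memNset// => Fix.
    by apply: nx; exists i.
  apply: (good_lim (u_ := fun n x => \sum_(i < n) \1_(F i) x) (M := 1)).
  + elim=> [|n IH].
      rewrite (_ : (fun x => _) = (fun=> 0)); first by apply: good_trig; exact: trig_cst.
      by apply/funext => x; rewrite big_ord0.
    rewrite (_ : (fun x => _) = (fun x => \sum_(i < n) \1_(F i) x + \1_(F n) x)).
      exact: good_add IH (gF n).
    by apply/funext => x; rewrite big_ord_recr.
  + move=> n x; have [/sumE[k ->]|/sum0 ->] := pselect ((\bigcup_k F k) x).
      by case: (k < n)%N; rewrite ?normr1 ?normr0.
    by rewrite normr0.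
  + move=> x; rewrite indicE.
    have [xF|xF] := pselect ((\bigcup_k F k) x).
      have [k kE] := sumE x xF; rewrite mem_set//; apply: cvg_near_cst.
      by exists k.+1 => // n /= kn; rewrite kE kn.
    rewrite memNset//; apply: cvg_near_cst; apply: nearW => n.
    exact: sum0.
exact: (eq_ind _ (fun Q : Prop => Q) mA _ (congr1 (fun S : set (set R) => S A) E)).
Qed.

Lemma trig_uniqueness A : measurable A ->
  \int[P]_w (\1_A (xi w) * W w) = kappa * fine (nu A).
Proof.
move=> /[dup] mA /good_indic [_ _ ->]; congr (_ * _).
by rewrite /Rintegral integral_indic// setIT.
Qed.

End trig_uniqueness.

(** * Joint law of Gaussian families *)

Section restricted_integral.
Context d (T : measurableType d) (R : realType) (P : {finite_measure set T -> \bar R}).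
Variables (D : set T) (mD : measurable D).

Lemma Rintegral_mrestr (f : T -> R) M : measurable_fun setT f ->
  (forall w, `|f w| <= M) ->
  \int[mrestr P mD]_w f w = \int[P]_w (\1_D w * f w).
Proof.
move=> mf fM; rewrite /Rintegral; congr fine.
rewrite (@negligible_integral _ _ _ (mrestr P mD) setT (~` D))//; last 3 first.
- exact: measurableC.
- exact: (@bounded_integrable _ _ _ (mrestr P mD) _ M).
- by rewrite /= /mrestr setICl measure0.
rewrite setDE setCK setTI.
transitivity (\int[P]_(w in D) (f w)%:E)%E.
  by apply: eq_measure_integral => A mA AD; rewrite /= /mrestr setIidl.
rewrite [LHS]integral_mkcond; apply: eq_integral => w _.
rewrite patchE indicE; by case: ifPn => _; rewrite ?mul1r ?mul0r.
Qed.

End restricted_integral.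

Section joint_law.
Context d (T : measurableType d) (R : realType).
Local Notation N := (normal_prob (0 : R) 1).
Local Notation S k := (projT2 (gauss_space R k)).

Fixpoint gauss_map (k : nat) (xi : nat -> T -> R) : T -> S k :=
  if k is k'.+1 then fun w => (xi 0%N w, gauss_map k' (fun i => xi i.+1) w)
  else fun=> tt.

Lemma measurable_gauss_map k (xi : nat -> T -> R) : (forall i, measurable_fun setT (xi i)) ->
  measurable_fun setT (gauss_map k xi).
Proof.
elim: k xi => [|k IH] xi mxi; first exact: measurable_cst.
apply: measurable_fun_pair; [exact: mxi|exact: (IH (fun i => xi i.+1) (fun i => mxi i.+1))].
Qed.

Lemma sqdist_gauss_map k xi w w' :
  sqdist (gauss_map k xi w) (gauss_map k xi w') = \sum_(i < k) (xi i w - xi i w') ^+ 2.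
Proof.
elim: k xi => [|k IH] xi; first by rewrite big_ord0.
by rewrite big_ord_recl /= IH.
Qed.

(** Induction on the number of coordinates. Restricting P to an event on the first coordinate leaves
    the same hypothesis for the remaining ones with a smaller total mass, which is why P is any
    finite measure. The resulting formula on rectangles determines the product measure. *)
Lemma gaussian_joint_law k (P : {finite_measure set T -> \bar R}) (xi : nat -> T -> R) :
  (forall i, measurable_fun setT (xi i)) ->
  (forall (t : nat -> R) (b : R), \int[P]_w cos (\sum_(i < k) t i * xi i w + b) =
     fine (P setT) * (cos b * normal_cos (Num.sqrt (\sum_(i < k) t i ^+ 2)))) ->
  forall X, measurable X ->
    P (gauss_map k xi @^-1` X) = (P setT * gauss_measure R k X)%E.
Proof.
elim: k P xi => [|k IH] P xi mxi law X mX.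
  have [Xtt|Xtt] := pselect (X tt).
    rewrite (_ : X = setT) ?preimage_setT; last by apply/seteqP; split=> // -[].
    by rewrite -[LHS]mule1; congr (_ * _)%E; apply: esym; exact: probability_setT.
  rewrite (_ : X = set0); last by apply/seteqP; split=> // -[].
  by rewrite preimage_set0 !measure0 mule0.
pose xi' i := xi i.+1.
have mxi' i : measurable_fun setT (xi' i) by exact: mxi.
have Pfin (A : set T) : measurable A -> (P A = (fine (P A))%:E)%E.
  by move=> mA; rewrite fineK// fin_num_measure.
pose p := NngNum (fine_ge0 (measure_ge0 P setT)).
have mpre (A : set R) : measurable A -> measurable (xi 0%N @^-1` A).
  by move=> mA; rewrite -[X in measurable X]setTI; exact: mxi.
have mlin (t : nat -> R) (b : R) :
    measurable_fun setT (fun w => \sum_(i < k) t i * xi' i w + b).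
  apply: measurable_funD => //; apply: measurable_sum => i.
  exact: measurable_funM.
have key (A : set R) (t : nat -> R) (b : R) : measurable A ->
  \int[P]_w (\1_A (xi 0%N w) * cos (\sum_(i < k) t i * xi' i w + b)) =
  p%:num * (cos b * normal_cos (Num.sqrt (\sum_(i < k) t i ^+ 2))) * fine (N A).
  move=> mA; apply: (@trig_uniqueness _ _ _ P N (xi 0%N) _ _ 1) => //.
  - exact: measurable_cos_comp.
  - by move=> w; rewrite ler_norml cos_geN1 cos_le1.
  move=> s e.
  (* The frequency c is prepended to t; [normal_cosM] splits the Euclidean norm of the extended list
     into two factors. *)
  have law2 c c' : \int[P]_w cos ((c * xi 0%N w + \sum_(i < k) t i * xi' i w) + c') =
      p%:num * (cos c' * (normal_cos c * normal_cos (Num.sqrt (\sum_(i < k) t i ^+ 2)))).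
    have := law (fun i => if i is i'.+1 then t i' else c) c'.
    rewrite big_ord_recl/= => h.
    have -> : normal_cos c * normal_cos (Num.sqrt (\sum_(i < k) t i ^+ 2)) =
      normal_cos (Num.sqrt (c ^+ 2 + \sum_(i < k) t i ^+ 2)) :> R.
      by rewrite normal_cosM sqr_sqrtr//; apply: sumr_ge0 => i _; exact: sqr_ge0.
    rewrite -h; apply: eq_Rintegral => w _; congr (cos (_ + _)).
    by rewrite big_ord_recl.
  have ic (u : T -> R) : measurable_fun setT u -> P.-integrable setT (EFin \o (fun w => 1 / 2 * cos (u w))).
    by move=> mu; exact: (integrableZl measurableT (1 / 2) (cos_integrable P mu)).
  have m1 c c' : measurable_fun setT (fun w => c * xi 0%N w + \sum_(i < k) t i * xi' i w + c').
    apply: measurable_funD => //; apply: measurable_funD; first exact: measurable_funM.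
    by apply: measurable_sum => i; exact: measurable_funM.
  (* Product-to-sum brings both cosines under one linear combination; since [normal_cos] is even,
     the two terms recombine into a product of cosines of the phases. *)
  transitivity (\int[P]_w (1 / 2 * cos ((s * xi 0%N w + \sum_(i < k) t i * xi' i w) + (e + b)) +
       1 / 2 * cos ((- s * xi 0%N w + \sum_(i < k) t i * xi' i w) + (b - e)))).
    apply: eq_Rintegral => w _; set L := \sum_(i < k) _.
    rewrite (_ : s * xi 0%N w + L + (e + b) = (L + b) + (s * xi 0%N w + e)); last by ring.
    rewrite (_ : - s * xi 0%N w + L + (b - e) = (L + b) - (s * xi 0%N w + e)); last by ring.
    move: (L + b) (s * xi 0%N w + e) => al be.
    by rewrite cosD cosB; field.
  rewrite RintegralD//; [|exact: ic|exact: ic].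
  have ic' (u : T -> R) : measurable_fun setT u -> P.-integrable setT (EFin \o (fun w => cos (u w))).
    by move=> mu; exact: cos_integrable.
  rewrite !RintegralZl//; [|exact: ic'|exact: ic'].
  rewrite !law2 normal_cosN.
  have -> : \int[N]_x cos (s * x + e) = cos e * normal_cos s.
    by rewrite -normal_cos_affine; apply: eq_Rintegral => x _; rewrite addrC.
  by rewrite cosD cosB; field.
have keyP (A : set R) : measurable A -> (P (xi 0%N @^-1` A) = (p%:num * fine (N A))%:E)%E.
  move=> mA; rewrite Pfin; last exact: mpre.
  (* Zero frequencies and phase make the weight equal to 1, which gives the law of the first
     coordinate. *)
  have := key A (fun=> 0) 0 mA.
  rewrite (_ : \int[P]_w _ = fine (P (xi 0%N @^-1` A))).
    rewrite (eq_bigr (fun=> 0)) ?big1_eq; last by move=> i _; rewrite expr0n.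
    by rewrite sqrtr0 normal_cos0 cos0 !mulr1 => ->.
  rewrite /Rintegral; congr fine.
  rewrite -[X in P X]setIT -integral_indic//; last exact: mpre.
  apply: eq_integral => w _; rewrite big1 ?addr0 ?cos0 ?mulr1// => i _.
  by rewrite mul0r.
pose m1 : {finite_measure set (measurableTypeR R) -> \bar R} := mscale p N.
have mG : measurable_fun setT (gauss_map k.+1 xi) by exact: measurable_gauss_map.
pose G : {mfun T >-> S k.+1} := HB.pack (gauss_map k.+1 xi)
  (isMeasurableFun.Build _ _ T (S k.+1) (gauss_map k.+1 xi) mG).
have prodE : forall X, measurable X ->
    (m1 \x gauss_measure R k)%E X = P (gauss_map k.+1 xi @^-1` X).
  apply: (@product_measure_unique _ _ _ _ _ m1 (gauss_measure R k) (pushforward P G)).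
  move=> A B mA mB.
  have mA' := mpre A mA.
  transitivity (mrestr P mA' (gauss_map k xi' @^-1` B)).
    by rewrite /= /mrestr /pushforward setIC.
  have law' (t : nat -> R) (b : R) :
      \int[mrestr P mA']_w cos (\sum_(i < k) t i * xi' i w + b) =
     fine (mrestr P mA' setT) * (cos b * normal_cos (Num.sqrt (\sum_(i < k) t i ^+ 2))).
    rewrite (@Rintegral_mrestr _ _ _ _ _ _ _ 1); last 2 first.
    - exact: measurable_cos_comp.
    - by move=> w; rewrite ler_norml cos_geN1 cos_le1.
    rewrite /mrestr setTI keyP// -[fine _%:E]/(p%:num * fine (N A)) mulrAC -key//.
  rewrite (IH (mrestr P mA') xi' mxi' law' B mB); congr (_ * _)%E.
  rewrite /= /mrestr setTI keyP// /mscale EFinM; congr (_ * _)%E.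
  by rewrite fineK// fin_num_measure.
rewrite -prodE// /product_measure1 ge0_integral_mscale//.
- by congr (_ * _)%E; rewrite /= fineK// fin_num_measure.
- exact: measurable_fun_xsection.
Qed.

End joint_law.

(** * Gram-Schmidt orthonormalization *)

Section gram_schmidt.
Context (R : realType) (V : lmodType R) (S : V -> Prop) (B : V -> V -> R).
Hypotheses (S0 : S 0) (SD : forall u v, S u -> S v -> S (u + v)).
Hypothesis SZ : forall c u, S u -> S (c *: u).
Hypothesis BC : forall u v, B u v = B v u.
Hypothesis BD : forall u v w, S u -> S v -> S w -> B (u + v) w = B u w + B v w.
Hypothesis BZ : forall c u w, S u -> S w -> B (c *: u) w = c * B u w.
Hypothesis B_ge0 : forall u, 0 <= B u u.

Let S_sum k (t : nat -> R) (e : nat -> V) : (forall i, S (e i)) ->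
  S (\sum_(i < k) t i *: e i).
Proof. by move=> Se; apply: big_ind => // i _; exact: SZ. Qed.

Let B_sum k (t : nat -> R) (e : nat -> V) w : (forall i, S (e i)) -> S w ->
  B (\sum_(i < k) t i *: e i) w = \sum_(i < k) t i * B (e i) w.
Proof.
move=> Se Sw; elim: k => [|k IH].
  by rewrite !big_ord0 -(scale0r (0 : V)) BZ// mul0r.
by rewrite !big_ord_recr/= BD ?IH ?BZ//; [exact: S_sum|exact: SZ].
Qed.

Let BN u w : S u -> S w -> B (- u) w = - B u w.
Proof. by move=> Su Sw; rewrite -scaleN1r BZ// mulN1r. Qed.

Let B0 u : S u -> B 0 u = 0.
Proof. by move=> Su; rewrite -(scale0r (0 : V)) BZ// mul0r. Qed.

Definition orthonormal_upto (k : nat) (e : nat -> V) :=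
  forall i j, (i < k)%N -> (j < k)%N -> B (e i) (e j) = (i == j)%:R.

Lemma orthonormal_sum_sqr k (e : nat -> V) (t : nat -> R) : (forall i, S (e i)) ->
  orthonormal_upto k e ->
  B (\sum_(i < k) t i *: e i) (\sum_(i < k) t i *: e i) = \sum_(i < k) t i ^+ 2.
Proof.
move=> Se on; rewrite B_sum//; last exact: S_sum.
apply: eq_bigr => i _; rewrite BC B_sum// (bigD1 i)//= on// eqxx mulr1.
rewrite big1 ?addr0 ?expr2// => j; rewrite -val_eqE/= => /negbTE ji.
by rewrite on// ji mulr0.
Qed.

(** B is semidefinite, as a covariance is, so vectors are expanded up to B-null remainders.
    Bilinearity is assumed on S, since covariances are additive on square-integrable functions. The
    second conclusion is Bessel's inequality. *)
Lemma gram_schmidt (l : seq V) : (forall v, v \in l -> S v) ->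
  exists k (e : nat -> V), [/\ forall i, S (e i), orthonormal_upto k e &
    forall v, v \in l -> exists t : nat -> R,
      B (v - \sum_(i < k) t i *: e i) (v - \sum_(i < k) t i *: e i) = 0 /\
      \sum_(i < k) t i ^+ 2 <= B v v].
Proof.
elim: l => [|v l IH] Sl; first by exists 0%N, (fun=> 0); split.
have [|k [e [Se on dec]]] := IH; first by move=> u ul; apply: Sl; rewrite inE ul orbT.
have Sv : S v by apply: Sl; rewrite inE eqxx.
pose t i := B v (e i); pose r := v - \sum_(i < k) t i *: e i.
have Ss : S (\sum_(i < k) t i *: e i) by exact: S_sum.
have SNs : S (- \sum_(i < k) t i *: e i) by rewrite -scaleN1r; exact: SZ.
have Sr : S r by exact: SD.
have re i : (i < k)%N -> B r (e i) = 0.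
  move=> ik; rewrite /r BD// BN// B_sum// (bigD1 (Ordinal ik))//= on// eqxx mulr1.
  rewrite big1 ?addr0 ?subrr// => j; rewrite -val_eqE/= => /negbTE ji.
  by rewrite on// ji mulr0.
have rr : B r r = B v v - \sum_(i < k) t i ^+ 2.
  rewrite {1}/r BD// BN// B_sum// (BC v) {1}/r BD// BN// B_sum//.
  rewrite [X in _ - X]big1 ?subr0; last by move=> i _; rewrite BC re ?mulr0.
  by congr (_ - _); apply: eq_bigr => i _; rewrite expr2 BC.
(* A residual of zero length adds no basis vector: v is already represented up to a null
   remainder. *)
have [r0|r_neq0] := eqVneq (B r r) 0.
  exists k, e; split => // u; rewrite inE => /predU1P[->|/dec//].
  by exists t; split; [exact: r0|rewrite -subr_ge0 -rr].
have r_gt0 : 0 < B r r by rewrite lt_neqAle eq_sym r_neq0 B_ge0.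
pose b := Num.sqrt (B r r).
have b0 : 0 < b by rewrite sqrtr_gt0.
have b2 : b ^+ 2 = B r r by rewrite sqr_sqrtr.
pose e' i := if (i < k)%N then e i else b^-1 *: r.
have e'E (c : nat -> R) : \sum_(i < k) c i *: e' i = \sum_(i < k) c i *: e i.
  by apply: eq_bigr => i _; rewrite /e' ltn_ord.
have e'k : e' k = b^-1 *: r by rewrite /e' ltnn.
have Se' i : S (e' i) by rewrite /e'; case: ifP => _ //; exact: SZ.
exists k.+1, e'; split => //.
- move=> i j; rewrite ltnS [(i <= k)%N]leq_eqVlt => /predU1P[->|ik];
    rewrite ltnS [(j <= k)%N]leq_eqVlt => /predU1P[->|jk].
  + rewrite eqxx e'k BZ//; last exact: SZ.
    by rewrite BC BZ// -b2 expr2 mulKf ?gt_eqF// mulVf// gt_eqF.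
  + by rewrite e'k /e' jk BZ// re// mulr0 gtn_eqF.
  + by rewrite BC e'k /e' ik BZ// re// mulr0 ltn_eqF.
  + by rewrite /e' ik jk on.
move=> u; rewrite inE => /predU1P[->|/dec[c [c0 cu]]].
  (* The coefficient of v on the new vector is the length b of its residual, so v is recovered
     exactly and the squares sum to B v v. *)
  exists (fun i => if (i < k)%N then t i else b); rewrite !big_ord_recr/= ltnn.
  under eq_bigr do rewrite ltn_ord.
  under [X in X + _ <= _]eq_bigr do rewrite ltn_ord.
  rewrite e'E e'k scalerA divff ?gt_eqF// scale1r; split.
    by rewrite opprD addrA -/r subrr B0.
  by rewrite b2 rr addrC subrK.
exists (fun i => if (i < k)%N then c i else 0); rewrite !big_ord_recr/= ltnn.
under eq_bigr do rewrite ltn_ord.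
under [X in X + _ <= _]eq_bigr do rewrite ltn_ord.
by rewrite e'E scale0r addr0 expr0n/= addr0.
Qed.

End gram_schmidt.

(** * Inner regularity of Borel measures *)

Section measure_smallness.
Context d (T : measurableType d) (R : realType) (P : probability T R).

Lemma measure_small_tail (B : nat -> set T) (e : R) : 0 < e ->
  (forall n, measurable (B n)) -> (forall n m, (n <= m)%N -> B m `<=` B n) ->
  \bigcap_n B n = set0 -> exists n, (P (B n) <= e%:E)%E.
Proof.
move=> e0 mB dB B0.
have B00 : (P (B 0%N) < +oo)%E by rewrite -ge0_fin_numE ?fin_num_measure.
have mcap : measurable (\bigcap_n B n) by rewrite B0.
have hB : {homo B : n m / (n <= m)%N >-> (m <= n)%O}.
  by move=> n m nm; apply/subsetPset; exact: dB.
have := nonincreasing_cvg_mu B00 mB mcap hB.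
rewrite B0 measure0 => /(_ [set x | (x < e%:E)%E]) [].
  by apply: open_nbhs_nbhs; split; [exact: open_ereal_lt_ereal|rewrite /= lte_fin].
by move=> N _ /(_ N (leqnn N)) /= /ltW h; exists N.
Qed.

Lemma measure_bigcup_small (B : nat -> set T) (e : R) : 0 < e ->
  (forall n, measurable (B n)) ->
  (forall n, P (B n) <= (e / (2 ^ n.+1)%:R)%:E)%E ->
  (P (\bigcup_n B n) <= e%:E)%E.
Proof.
move=> e0 mB Be.
apply: (@le_trans _ _ (\sum_(n <oo) P (B n))%E).
  by apply: measure_sigma_subadditive => //; exact: bigcupT_measurable.
have := @epsilon_trick R (fun=> 0%E) e predT (fun=> lexx _) (ltW e0).
rewrite [X in (_ <= X + _)%E]eseries0// add0e => h; apply: le_trans h.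
by apply: lee_nneseries => // n _; rewrite add0e.
Qed.

End measure_smallness.

Lemma ultra_bigcup (T : Type) (G : set_system T) (A : nat -> set T) (N : nat) :
  UltraFilter G -> G (\bigcup_(i in [set i | (i < N)%N]) A i) -> exists i, G (A i).
Proof.
move=> UG; elim: N => [|N IH] GA.
  have /filter_not_empty[] : G set0 by apply: filterS GA => x [].
have [?|GN] := in_ultra_setVsetC (A N) UG; first by exists N.
apply: IH; apply: filterS (filterI GA GN) => x [[i /= iN Aix] NAx].
exists i => //=; move: iN; rewrite ltnS leq_eqVlt => /predU1P[iN|//].
by rewrite iN in Aix.
Qed.

Section regularity.
Context (R : realType) (F : tvsType R) (P : probability (borel F) R).
Variable dist : F -> F -> R.
Hypotheses (d_ge0 : forall x y, 0 <= dist x y).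
Hypothesis d_eq0 : forall x y, dist x y = 0 <-> x = y.
Hypothesis dC : forall x y, dist x y = dist y x.
Hypothesis d_triangle : forall x y z, dist x z <= dist x y + dist y z.
Hypothesis d_nbhs : forall (x : F) (A : set F),
  nbhs x A <-> exists2 e : R, 0 < e & [set y | dist x y < e] `<=` A.

Let dxx x : dist x x = 0. Proof. by apply/d_eq0. Qed.

Let closed_cball (x : F) r : closed ([set y | dist x y <= r] : set F).
Proof.
rewrite -[X in closed X]setCK; apply: open_closedC.
rewrite openE => y /= /negP; rewrite -ltNge => ry.
apply/d_nbhs; exists (dist x y - r); first by rewrite subr_gt0.
move=> z /= yz; apply/negP; rewrite -ltNge.
have := d_triangle x z y; rewrite (dC z y); lra.
Qed.

Lemma borel_open (U : set F) : open U -> measurable (U : set (borel F)).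
Proof. by move=> oU; exact: sub_sigma_algebra. Qed.

Lemma borel_closed (C : set F) : closed C -> measurable (C : set (borel F)).
Proof.
by move=> cC; rewrite -[C]setCK; apply: measurableC; apply: borel_open; exact: closed_openC.
Qed.

(** Inner closed and outer open approximation are required together because complementation
    exchanges them; the class is then a sigma-algebra containing the open sets. *)
Let regular (A : set F) := measurable (A : set (borel F)) /\ forall e : R, 0 < e ->
  exists C U : set F, [/\ closed C, open U, C `<=` A, A `<=` U &
    (P (U `\` C : set (borel F)) <= e%:E)%E].

Let regular_open U : open U -> regular U.
Proof.
move=> oU; split; first exact: borel_open.
move=> e e0.
(* The points at distance at least 1/(n + 1) from the complement of U; they increase to U. *)
pose C (n : nat) : set F := [set x | forall y, ~ U y -> n.+1%:R^-1 <= dist x y].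
have cC n : closed (C n).
  rewrite (_ : C n = \bigcap_(y in ~` U) ~` [set x | dist y x < n.+1%:R^-1]).
    apply: closed_bigI => y _; apply: open_closedC.
    rewrite openE => x /= xy; apply/d_nbhs.
    exists (n.+1%:R^-1 - dist y x); first by rewrite subr_gt0.
    by move=> z /=; rewrite ltrBrDl; exact: le_lt_trans (d_triangle y x z).
  apply/seteqP; split=> x /= Cx y Uy; first by apply/negP; rewrite -leNgt dC; exact: Cx.
  by rewrite leNgt dC; apply/negP; exact: Cx.
have CU n : C n `<=` U.
  move=> x Cx; apply: contrapT => Ux; have := Cx x Ux; rewrite dxx.
  by rewrite leNgt invr_gt0 ltr0n.
have mUC n : measurable (U `\` C n : set (borel F)).
  by apply: measurableD; [exact: borel_open|exact: borel_closed].
have dec n m : (n <= m)%N -> (U `\` C m) `<=` (U `\` C n).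
  move=> nm x [Ux nC]; split => // Cx; apply: nC => y Uy.
  apply: le_trans (Cx y Uy).
  by rewrite lef_pV2 ?posrE// ler_nat ltnS.
have cap0 : \bigcap_n (U `\` C n) = set0.
  apply/seteqP; split=> // x UCx; have [Ux _] := UCx 0%N I.
  have /d_nbhs[r r0 rU] : nbhs x U by exact: open_nbhs_nbhs.
  have [N _ /(_ N (leqnn N)) /= Nr] := near_infty_natSinv_lt (PosNum r0).
  have [_] := UCx N I; apply => y Uy; rewrite leNgt; apply/negP => xy.
  by apply: Uy; apply: rU; exact: lt_trans xy Nr.
have [n Pn] := measure_small_tail P e0 mUC dec cap0.
by exists (C n), U; split.
Qed.

Let regular_setC A : regular A -> regular (~` A).
Proof.
move=> [mA rA]; split; first exact: measurableC.
move=> e /rA [C [U [cC oU CA AU UC]]]; exists (~` U), (~` C); split.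
- exact: open_closedC.
- exact: closed_openC.
- exact: subsetC.
- exact: subsetC.
- by rewrite setDE setCK setIC -setDE.
Qed.

Let regular_bigcup (A : nat -> set F) : (forall n, regular (A n)) -> regular (\bigcup_n A n).
Proof.
move=> rA; split; first by apply: bigcupT_measurable => n; have [] := rA n.
move=> e e0.
have e2 : 0 < e / 2 by lra.
have en n : 0 < e / 2 / (2 ^ n.+1)%:R by rewrite divr_gt0// ltr0n expn_gt0.
have /choice[CU HCU] n : exists CU : set F * set F,
    [/\ closed CU.1, open CU.2, CU.1 `<=` A n, A n `<=` CU.2 &
    (P (CU.2 `\` CU.1 : set (borel F)) <= (e / 2 / (2 ^ n.+1)%:R)%:E)%E].
  by have [_ /(_ _ (en n))[C [U ?]]] := rA n; exists (C, U).
pose C n := (CU n).1; pose U n := (CU n).2.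
have cC n : closed (C n) by have [] := HCU n.
have oU n : open (U n) by have [] := HCU n.
(* A countable union of closed sets need not be closed, so it is truncated. Half of the error pays
   for the truncation and the other half for the geometric series. *)
pose CN n : set F := \bigcup_(i in [set i | (i < n)%N]) C i.
have cCN n : closed (CN n) by apply: closed_bigcup => //; exact: finite_II.
have mCC : measurable (\bigcup_n C n : set (borel F)).
  by apply: bigcupT_measurable => n; exact: borel_closed.
pose B n : set (borel F) := (\bigcup_n C n) `\` CN n.
have mB n : measurable (B n) by apply: measurableD => //; exact: borel_closed.
have dec n m : (n <= m)%N -> B m `<=` B n.
  move=> nm x [Cx nC]; split => // -[i /= ik Cix]; apply: nC.
  by exists i => //=; exact: leq_trans ik nm.
have cap0 : \bigcap_n B n = set0.
  apply/seteqP; split=> // x Bx; have [[i _ Cix] _] := Bx 0%N I.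
  by have [_] := Bx i.+1 I; apply; exists i => /=.
have [N PN] := measure_small_tail P e2 mB dec cap0.
exists (CN N), (\bigcup_n U n); split.
- exact: cCN.
- by apply: bigcup_open => n _; exact: oU.
- by move=> x [i _ Cix]; exists i => //; have [_ _ h _ _] := HCU i; exact: h.
- by move=> x [i _ Aix]; exists i => //; have [_ _ _ h _] := HCU i; exact: h.
pose D n : set (borel F) := U n `\` C n.
have mD n : measurable (D n).
  by apply: measurableD; [exact: borel_open|exact: borel_closed].
have PD : (P (\bigcup_n D n) <= (e / 2)%:E)%E.
  by apply: measure_bigcup_small => // n; have [] := HCU n.
have mDD : measurable (\bigcup_n D n) by exact: bigcupT_measurable.
apply: (@le_trans _ _ (P (\bigcup_n D n `|` B N))).
  apply: le_measure; rewrite ?inE.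
  - apply: measurableD; last exact: borel_closed.
    by apply: borel_open; apply: bigcup_open => n _; exact: oU.
  - exact: measurableU.
  move=> x [[i _ Uix] nC]; have [Cx|Cx] := pselect ((\bigcup_n C n) x).
    by right.
  by left; exists i => //; split => // Cix; apply: Cx; exists i.
apply: (le_trans (measureU2 _ mDD (mB N))).
by rewrite (splitr e) EFinD leeD.
Qed.

Lemma borel_regular A : measurable (A : set (borel F)) -> regular A.
Proof.
move=> mA; apply: (@smallest_sub _ (sigma_algebra setT) (@open F) regular) => //.
  split.
  - by apply: regular_open; exact: open0.
  - by move=> B rB; rewrite setTD; exact: regular_setC.
  - exact: regular_bigcup.
Qed.

Hypothesis sepF : separable F.
Hypothesis completeF : forall u : nat -> F,
  (forall e : R, 0 < e -> exists N : nat,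
     forall m n : nat, (N <= m)%N -> (N <= n)%N -> dist (u m) (u n) < e) ->
  exists l : F, u @ \oo --> l.

Let dense_seq : exists s : nat -> F, forall x (r : R), 0 < r -> exists n, dist (s n) x <= r.
Proof.
have [S /countable_injP[f finj] dS] := sepF.
(* An enumeration of S through its injection into the integers; codes that are not attained yield
   the default 0, a harmless extra term. *)
exists (fun n => xget 0 [set x | S x /\ f x = n]) => x r r0.
have [y [xy Sy]] : [set y | dist x y < r]° `&` S !=set0.
  apply: dS; last exact: open_interior.
  exists x; apply/d_nbhs; exists r => //.
exists (f y); rewrite (xget_unique _ (x := y)); last 2 first.
- by [].
- by move=> z [Sz fz]; apply: finj => //; rewrite inE.
by rewrite dC ltW//; exact: (interior_subset xy).
Qed.

(** Ulam's theorem. At each scale 1/(n + 1), finitely many balls around a dense sequence carry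
    almost all the mass, and the intersection over all scales is closed and totally bounded. *)
Lemma borel_tight (e : R) : 0 < e -> exists K : set F,
  [/\ compact K, closed K & (P (~` K : set (borel F)) <= e%:E)%E].
Proof.
move=> e0; have [s ds] := dense_seq.
pose A (n N : nat) : set F := \bigcup_(i in [set i | (i < N)%N])
  [set y | dist (s i) y <= n.+1%:R^-1].
have cA n N : closed (A n N).
  by apply: closed_bigcup => [|i _]; [exact: finite_II|exact: closed_cball].
have mA n N : measurable (~` A n N : set (borel F)).
  by apply: measurableC; exact: borel_closed.
have /choice[N HN] n : exists N, (P (~` A n N : set (borel F)) <= (e / (2 ^ n.+1)%:R)%:E)%E.
  apply: measure_small_tail => //.
  - by rewrite divr_gt0// ltr0n expn_gt0.
  - move=> k m km; apply: subsetC => x [i /= ik xi]; exists i => //=.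
    exact: leq_trans ik km.
  - apply/seteqP; split=> // x Ax.
    have n0 : 0 < n.+1%:R^-1 :> R by rewrite invr_gt0.
    have [i xi] := ds x _ n0.
    by apply: (Ax i.+1 I); exists i => /=.
exists (\bigcap_n A n (N n)); split.
- rewrite compact_ultra => G UG GK.
  (* An ultrafilter selects one ball at each scale. Any two selected balls meet, so their centers
     form a Cauchy sequence, whose limit is a limit of the ultrafilter. *)
  have /choice[i Hi] n : exists i, G [set y | dist (s i) y <= n.+1%:R^-1].
    apply: (@ultra_bigcup _ _ (fun i => [set y | dist (s i) y <= n.+1%:R^-1]) (N n)) => //.
    by apply: filterS GK => x /(_ n I).
  have si n m : dist (s (i n)) (s (i m)) <= n.+1%:R^-1 + m.+1%:R^-1.
    have [x [/= xn xm]] := filter_ex (filterI (Hi n) (Hi m)).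
    by apply: (le_trans (d_triangle _ x _)); rewrite (dC x) lerD.
  have [l sl] : exists l : F, (s \o i) @ \oo --> l.
    apply: completeF => r r0; have r2 : 0 < r / 2 by lra.
    have [M _ HM] := near_infty_natSinv_lt (PosNum r2).
    exists M => m n Mm Mn; apply: (le_lt_trans (si m n)).
    by rewrite (splitr r); apply: ltrD; exact: HM.
  have Gl : G --> l.
    move=> B /d_nbhs[r r0 rB]; have r2 : 0 < r / 2 by lra.
    have [M _ HM] := near_infty_natSinv_lt (PosNum r2).
    have [M' _ HM'] : ((s \o i) @ \oo) [set y | dist l y < r / 2].
      by apply: sl; apply/d_nbhs; exists (r / 2).
    pose m := maxn M M'.
    have h1 := HM m (leq_maxl _ _); have h2 := HM' m (leq_maxr _ _).
    apply: filterS (Hi m) => x /= xm; apply: rB => /=.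
    rewrite (splitr r); apply: (le_lt_trans (d_triangle l (s (i m)) x)).
    by apply: ltrD => //; exact: le_lt_trans xm h1.
  exists l; split => //.
  have cK : closed (\bigcap_n A n (N n)) by apply: closed_bigI => n _; exact: cA.
  by apply: cK => B /Gl GB; exact: filter_ex (filterI GK GB).
- by apply: closed_bigI => n _; exact: cA.
- by rewrite setC_bigcap; apply: measure_bigcup_small.
Qed.

Lemma borel_inner_regular (A : set F) (e : R) : measurable (A : set (borel F)) -> 0 < e ->
  exists K : set F, [/\ compact K, closed K, K `<=` A &
    (P (A `\` K : set (borel F)) <= e%:E)%E].
Proof.
move=> mA e0; have e2 : 0 < e / 2 by lra.
have [K [kK cK PK]] := borel_tight e2.
have [_ /(_ _ e2)[C [U [cC oU CA AU PUC]]]] := borel_regular mA.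
exists (K `&` C); split.
- exact: compact_closedI.
- exact: closedI.
- by move=> x [_ /CA].
have mK := borel_closed cK; have mC := borel_closed cC; have mU := borel_open oU.
apply: (@le_trans _ _ (P ((~` K : set (borel F)) `|` (U `\` C)))).
  apply: le_measure; rewrite ?inE.
  - by apply: measurableD => //; exact: measurableI.
  - by apply: measurableU; [exact: measurableC|exact: measurableD].
  move=> x [Ax KCx]; have [Kx|Kx] := pselect (K x); last by left.
  by right; split; [exact: AU|move=> Cx; apply: KCx].
apply: (le_trans (measureU2 _ (measurableC mK) (measurableD mU mC))).
by rewrite (splitr e) EFinD leeD.
Qed.

End regularity.

(** * Continuous linear functionals *)

Section functionals.
Context (R : realType) (F : tvsType R) (gamma : probability (borel F) R).
Hypothesis gaussF : gaussian_measure gamma.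

(** The unbundled form lets sums and multiples be taken in the module of all functions F -> R, where
    Gram-Schmidt operates. *)
Definition functional (v : F -> R^o) : Prop := linear v /\ continuous v.

Lemma functional0 : functional 0.
Proof.
split; first by move=> a u w; change (0 = a *: (0 : R^o) + 0); rewrite scaler0 addr0.
exact: cst_continuous.
Qed.

Lemma functionalD u v : functional u -> functional v -> functional (u + v).
Proof.
move=> [lu cu] [lv cv]; split.
  move=> a x y; change (u (a *: x + y) + v (a *: x + y) = a *: (u x + v x) + (u y + v y)).
  by rewrite lu lv scalerDr addrACA.
by move=> x; apply: (@continuousD R R^o F); [exact: cu|exact: cv].
Qed.

Lemma functionalZ c u : functional u -> functional (c *: u).
Proof.
move=> [lu cu]; split.
  move=> a x y; change (c *: u (a *: x + y) = a *: (c *: u x) + c *: u y).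
  by rewrite lu scalerDr !scalerA mulrC.
by move=> x; apply: (@continuousZl_tmp R R^o F); exact: cu.
Qed.

Lemma functional_linear (v : F -> R^o) : functional v ->
  exists2 l : {linear F -> R^o}, continuous l & v = l.
Proof.
move=> [lv cv]; pose L : {linear F -> R^o} := HB.pack v (GRing.isLinear.Build R F R^o _ v lv).
by exists L.
Qed.

Lemma functional_measurable v : functional v ->
  measurable_fun setT (v : borel F -> R).
Proof.
move=> [_ /continuousP cv]; apply: (measurability _ (RGenOpens.measurableE R)).
move=> _ [_ [a [b ->] <-]]; rewrite setTI; apply: borel_open.
by apply: cv; exact: interval_open.
Qed.

Lemma functional_affine_normal v : functional v ->
  exists m s, 0 <= s /\ affine_normal gamma (v : borel F -> R) m s.
Proof.
move=> fv; apply: gaussian_law_affine_normal; first exact: functional_measurable.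
by have [l cl ->] := functional_linear fv; exact: gaussF.
Qed.

Lemma functional_Lfun2 (v : F -> R^o) : functional v -> (v : borel F -> R) \in Lfun gamma 2%:E.
Proof.
move=> fv; have [m [s [_ vN]]] := functional_affine_normal fv.
by apply: affine_normal_Lfun2 vN; exact: functional_measurable.
Qed.

Lemma functional_Lfun1 (v : F -> R^o) : functional v -> (v : borel F -> R) \in Lfun gamma 1.
Proof.
move=> fv; apply: Lfun_subset12; first by apply: fin_num_measure.
exact: functional_Lfun2.
Qed.

Definition mean (v : F -> R^o) : R := fine 'E_gamma[(v : borel F -> R)].

(** Dividing by the second moment of the standard normal law makes the value at (v, v) exactly s^2
    when v is distributed as m + s xi. *)
Definition normalized_cov (u v : F -> R^o) : R :=
  fine (covariance gamma (u : borel F -> R) (v : borel F -> R)) / normal_sqr R.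

Lemma functional_cov_fin (u v : F -> R^o) : functional u -> functional v ->
  covariance gamma (u : borel F -> R) (v : borel F -> R) \is a fin_num.
Proof.
move=> fu fv; apply: covariance_fin_num; [exact: functional_Lfun1|exact: functional_Lfun1|].
by apply: Lfun2_mul_Lfun1; exact: functional_Lfun2.
Qed.

Lemma normalized_covC u v : normalized_cov u v = normalized_cov v u.
Proof. by rewrite /normalized_cov covarianceC. Qed.

Lemma normalized_covD u v w : functional u -> functional v -> functional w ->
  normalized_cov (u + v) w = normalized_cov u w + normalized_cov v w.
Proof.
move=> fu fv fw; rewrite /normalized_cov covarianceDl ?functional_Lfun2//.
by rewrite fineD ?functional_cov_fin// mulrDl.
Qed.

Lemma normalized_covZ c u w : functional u -> functional w ->
  normalized_cov (c *: u) w = c * normalized_cov u w.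
Proof.
move=> fu fw; rewrite /normalized_cov.
have -> : (c *: u : borel F -> R) = (c \o* (u : borel F -> R))%R.
  by apply/funext => x; rewrite !fctE /= mulrC.
rewrite covarianceZl; [|exact: functional_Lfun1|exact: functional_Lfun1|].
  by rewrite fineM ?functional_cov_fin// mulrA.
by apply: Lfun2_mul_Lfun1; exact: functional_Lfun2.
Qed.

Lemma normalized_cov_ge0 u : 0 <= normalized_cov u u.
Proof.
rewrite divr_ge0 ?(ltW (normal_sqr_gt0 R))// fine_ge0//; exact: variance_ge0.
Qed.

Lemma functional_normal v : functional v ->
  affine_normal gamma (v : borel F -> R) (mean v) (Num.sqrt (normalized_cov v v)).
Proof.
move=> fv; have [m [s [s0 vN]]] := functional_affine_normal fv.
have mv := functional_measurable fv.
have -> : mean v = m by rewrite /mean (affine_normal_expectation vN).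
suff -> : normalized_cov v v = s ^+ 2 by rewrite sqrtr_sqr ger0_norm.
have := affine_normal_variance vN; rewrite /normalized_cov /variance => ->.
by rewrite /= mulfK// gt_eqF// normal_sqr_gt0.
Qed.

Lemma meanD u v : functional u -> functional v -> mean (u + v) = mean u + mean v.
Proof.
move=> fu fv; rewrite /mean expectationD ?functional_Lfun1//.
by rewrite fineD// expectation_fin_num// functional_Lfun1.
Qed.

Lemma meanZ c u : functional u -> mean (c *: u) = c * mean u.
Proof.
move=> fu; rewrite /mean.
have -> : (c *: u : borel F -> R) = (c \o* (u : borel F -> R))%R.
  by apply/funext => x; rewrite !fctE /= mulrC.
by rewrite expectationZl ?functional_Lfun1// fineM// expectation_fin_num// functional_Lfun1.
Qed.

Lemma functional_sum k (t : nat -> R) (e : nat -> F -> R^o) : (forall i, functional (e i)) ->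
  functional (\sum_(i < k) t i *: e i).
Proof.
move=> fe; apply: (big_ind functional) => [|u v|i _].
- exact: functional0.
- exact: functionalD.
- exact: functionalZ.
Qed.

Lemma mean_sum k (t : nat -> R) (e : nat -> F -> R^o) : (forall i, functional (e i)) ->
  mean (\sum_(i < k) t i *: e i) = \sum_(i < k) t i * mean (e i).
Proof.
move=> fe; elim: k => [|k IH].
  rewrite !big_ord0 -(scale0r (0 : F -> R^o)) meanZ ?mul0r//; exact: functional0.
rewrite !big_ord_recr/= meanD ?meanZ ?IH//; last exact: functionalZ.
exact: functional_sum.
Qed.

Lemma normalized_cov_eq0 v : functional v -> normalized_cov v v = 0 ->
  gamma ([set w | v w != mean v] : set (borel F)) = 0%E.
Proof.
move=> fv v0; have mv := functional_measurable fv.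
have := functional_normal fv; rewrite v0 sqrtr0 => vN.
have := affine_normal_sqr vN (mean v); rewrite subrr !expr0n/= mul0r addr0 => int0.
have mf : measurable_fun setT (fun w : borel F => ((v w - mean v) ^+ 2)%:E).
  by apply/measurable_EFinP; apply: measurable_funX; exact: measurable_funB.
have mN : measurable ([set w | v w != mean v] : set (borel F)).
  rewrite (_ : [set w | _] = ~` (v @^-1` [set mean v])).
    by apply: measurableC; rewrite -[X in measurable X]setTI; exact: mv.
  by apply/seteqP; split=> w /= /eqP.
have /(ae_eq_integral_abs gamma measurableT mf) : (\int[gamma]_w `|((v w - mean v) ^+ 2)%:E| = 0)%E.
  apply: etrans int0; apply: eq_integral => w _ /=; by rewrite ger0_norm// sqr_ge0.
move=> ae0; apply/(negligibleP gamma mN); apply: negligibleS ae0 => w /= vw H.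
move: (H I) => -[/eqP]; rewrite sqrf_eq0 subr_eq0.
by rewrite (negbTE vw).
Qed.

Definition centered (e : nat -> F -> R^o) (i : nat) : borel F -> R :=
  fun w => e i w - mean (e i).

Lemma measurable_centered e i : (forall i, functional (e i)) -> measurable_fun setT (centered e i).
Proof. by move=> fe; apply: measurable_funB => //; exact: functional_measurable. Qed.

Lemma sum_functionE k (t : nat -> R) (e : nat -> F -> R^o) w :
  (\sum_(i < k) t i *: e i) w = \sum_(i < k) t i * e i w.
Proof.
elim: k => [|k IH]; first by rewrite !big_ord0.
by rewrite !big_ord_recr/= -IH.
Qed.

(** A linear combination of the e_i is again a functional, hence Gaussian, and orthonormality gives
    it normalized variance sum t_i^2. This is the cosine hypothesis of [gaussian_joint_law] with
    total mass 1. *)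
Lemma orthonormal_law k (e : nat -> F -> R^o) : (forall i, functional (e i)) ->
  orthonormal_upto normalized_cov k e ->
  forall X, measurable X ->
    gamma (gauss_map k (centered e) @^-1` X) = gauss_measure R k X.
Proof.
move=> fe on X mX.
have g1 := probability_setT gamma.
rewrite -[RHS]mul1e -g1.
apply: gaussian_joint_law => // [i|t b]; first exact: measurable_centered.
rewrite [X in fine X](_ : _ = 1%E); last exact: g1.
rewrite mul1r.
pose L := \sum_(i < k) t i *: e i.
have fL : functional L by exact: functional_sum.
have := affine_normal_cos (b - mean L) (functional_normal fL).
rewrite (addrC (mean L)) subrK (orthonormal_sum_sqr functional0 functionalD functionalZ normalized_covC
  normalized_covD normalized_covZ t fe on) => <-.
apply: eq_Rintegral => w _; congr cos.
rewrite /L sum_functionE mean_sum//.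
rewrite [RHS]addrCA [RHS]addrC; congr (_ + _).
rewrite -sumrB; apply: eq_bigr => i _.
by rewrite /centered mulrBr.
Qed.

End functionals.

(** * Separated sets and tails *)

Section separation.
Context (R : realType) (F : tvsType R) (gamma : probability (borel F) R).
Hypothesis gaussF : gaussian_measure gamma.
Local Notation kappa := (normal_sqr R).

(** The inequality r < [cm_norm gamma (c - a)] with the supremum unfolded; differences outside the
    Cameron-Martin space are included. *)
Definition cm_separated (r : R) (A C : set F) := forall a c, A a -> C c ->
  exists2 l : {linear F -> R^o},
    continuous l /\ (variance gamma (l : borel F -> R) <= 1)%E & r < l (c - a).

Lemma finite_functionals_separated r (A C : set F) :
  compact A -> compact C -> cm_separated r A C ->
  exists L : seq (F -> R^o),
    (forall v, v \in L -> functional v /\ normalized_cov gamma v v <= kappa^-1) /\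
    (forall a c, A a -> C c -> exists2 v, v \in L & r < v c - v a).
Proof.
move=> kA kC sepAC.
(* The zero functional serves as a default off A x C, so that a functional can be chosen for every
   z. *)
have sep z : exists l : {linear F -> R^o}, (A `*` C) z ->
    [/\ continuous l, (variance gamma (l : borel F -> R) <= 1)%E & r < l (z.2 - z.1)].
  have [[zA zC]|nz] := pselect ((A `*` C) z); last by exists \0.
  by have [l [? ?] ?] := sepAC _ _ zA zC; exists l.
have [l lP] := choice sep.
(* The product is given a base point in order to use [compact_cover]. *)
pose X : ptopologicalType := HB.pack (F * F)%type (isPointed.Build (F * F)%type (0, 0)).
have := compact_setX kA kC; rewrite (compact_cover X) => cov.
pose U (z : F * F) : set (F * F) := [set x | r < l z x.2 - l z x.1].
have [||D DAC Dcov] := cov (F * F)%type (A `*` C) U.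
- move=> z zAC; have [cl _ _] := lP z zAC.
  rewrite (_ : U z = (fun x : F * F => l z x.2 - l z x.1) @^-1` `]r, +oo[).
    apply: open_comp; last exact: interval_open.
    move=> x _; apply: (@continuousB R R^o (F * F)%type).
      by apply: continuous_comp; [exact: cvg_snd|exact: cl].
    by apply: continuous_comp; [exact: cvg_fst|exact: cl].
  by apply/seteqP; split=> x /=; rewrite in_itv/= andbT.
- move=> z zAC; exists z => //; have [_ _] := lP z zAC.
  by rewrite /U /= linearB.
exists [seq (l z : F -> R^o) | z <- finmap.enum_fset D]; split.
  move=> v /mapP[z zD ->]; have zAC : (A `*` C) z by have := DAC z zD; rewrite inE.
  have [cl vl _] := lP z zAC.
  have fl : functional (l z) by split => //; exact: linearP.
  split => //; rewrite /normalized_cov -[leRHS]mul1r ler_pM2r ?invr_gt0 ?normal_sqr_gt0//.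
  rewrite -lee_fin fineK//; exact: functional_cov_fin.
move=> a c Aa Cc; have [z zD /= rz] := Dcov (a, c) (conj Aa Cc).
by exists (l z) => //; apply/mapP; exists z.
Qed.

Lemma null_set_seq (I : eqType) (L : seq I) (B : I -> set (borel F)) :
  (forall v, v \in L -> measurable (B v)) -> (forall v, v \in L -> gamma (B v) = 0%E) ->
  exists N, [/\ measurable N, gamma N = 0%E & forall v, v \in L -> B v `<=` N].
Proof.
elim: L => [|v L IH] mB B0; first by exists set0; split => //; rewrite measure0.
have [u uL|u uL|N [mN N0 BN]] := IH.
- by apply: mB; rewrite inE uL orbT.
- by apply: B0; rewrite inE uL orbT.
have mBv : measurable (B v) by apply: mB; rewrite inE eqxx.
exists (B v `|` N); split.
- exact: measurableU.
- have N0' : (gamma N <= 0)%E by rewrite N0.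
  have B0' : (gamma (B v) <= 0)%E by rewrite B0// inE eqxx.
  apply/eqP; rewrite -measure_le0; apply: (le_trans (measureU2 _ mBv mN)).
  by rewrite -[leRHS]adde0; apply: leeD.
- move=> u; rewrite inE => /predU1P[->|/BN uN]; first exact: subsetUl.
  by apply: subset_trans uN _; exact: subsetUr.
Qed.

(** Off the null set N each selected functional is a constant plus sum t_i xi_i with sum t_i^2 <=
    1/kappa. A gap larger than r in its values therefore forces squared distance at least kappa r^2
    between the Euclidean images. *)
Lemma gaussian_separated_compact r (A C : set F) : 0 < r ->
  compact A -> compact C -> measurable (A : set (borel F)) -> measurable (C : set (borel F)) ->
  cm_separated r A C ->
  (gamma (A : set (borel F)) * gamma (C : set (borel F)) <=
    (expR ((1 - kappa * r ^+ 2 / 3) / 4))%:E)%E.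
Proof.
move=> r0 kA kC mA mC sepAC.
have [L [Lf LS]] := finite_functionals_separated kA kC sepAC.
have k0 : 0 < kappa := normal_sqr_gt0 R.
have [k [e [fe on dec]]] : exists k (e : nat -> F -> R^o),
    [/\ forall i, functional (e i), orthonormal_upto (normalized_cov gamma) k e &
    forall v, v \in L -> exists t : nat -> R,
      normalized_cov gamma (v - \sum_(i < k) t i *: e i) (v - \sum_(i < k) t i *: e i) = 0 /\
      \sum_(i < k) t i ^+ 2 <= normalized_cov gamma v v].
  apply: (@gram_schmidt R _ (@functional R F) (normalized_cov gamma)).
  - exact: functional0.
  - by move=> u v; exact: functionalD.
  - by move=> c u; exact: functionalZ.
  - exact: normalized_covC.
  - by move=> u v w; exact: normalized_covD.
  - by move=> c u w; exact: normalized_covZ.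
  - exact: normalized_cov_ge0.
  - by move=> v vL; have [] := Lf v vL.
have /choice[t tP] v : exists t : nat -> R, v \in L ->
   normalized_cov gamma (v - \sum_(i < k) t i *: e i) (v - \sum_(i < k) t i *: e i) = 0 /\
   \sum_(i < k) t i ^+ 2 <= normalized_cov gamma v v.
  have [vL|vL] := boolP (v \in L); last by exists (fun=> 0).
  by have [t tv] := dec v vL; exists t.
pose rem v : F -> R^o := v - \sum_(i < k) t v i *: e i.
have frem v : v \in L -> functional (rem v).
  move=> vL; apply: functionalD; first by have [] := Lf v vL.
  by rewrite -scaleN1r; apply: functionalZ; exact: functional_sum.
pose bad v : set (borel F) := [set w | rem v w != mean gamma (rem v)].
have mbad v : v \in L -> measurable (bad v).
  move=> vL; rewrite (_ : bad v = ~` (rem v @^-1` [set mean gamma (rem v)])).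
    apply: measurableC; rewrite -[X in measurable X]setTI.
    exact: (functional_measurable (frem v vL)).
  by apply/seteqP; split=> w /= /eqP.
have bad0 v : v \in L -> gamma (bad v) = 0%E.
  by move=> vL; apply: normalized_cov_eq0 => //; [exact: frem|have [] := tP v vL].
have [N [mN N0 badN]] := null_set_seq mbad bad0.
pose xi := centered gamma e.
have mxi i : measurable_fun setT (xi i) by exact: measurable_centered.
pose Xi : borel F -> projT2 (gauss_space R k) := gauss_map k xi.
have mXi : measurable_fun setT Xi by exact: measurable_gauss_map.
have sepXi z w : (Xi @` (A `\` N)) z -> (Xi @` (C `\` N)) w ->
    kappa * r ^+ 2 <= sqdist z w.
  move=> [a [Aa aN] <-] [c [Cc cN] <-]; rewrite sqdist_gauss_map.
  have [v vL rv] := LS a c Aa Cc.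
  have [_ tv] := tP v vL; have [_ vk] := Lf v vL.
  have rem_a : rem v a = mean gamma (rem v).
    by apply: contrapT => /eqP h; apply: aN; exact: (badN v vL).
  have rem_c : rem v c = mean gamma (rem v).
    by apply: contrapT => /eqP h; apply: cN; exact: (badN v vL).
  have vE x : v x = rem v x + \sum_(i < k) t v i * e i x.
    by rewrite -sum_functionE subrK.
  have vca : v c - v a = \sum_(i < k) t v i * (xi i c - xi i a).
    rewrite !vE rem_a rem_c opprD addrACA subrr add0r -sumrB.
    by apply: eq_bigr => i _; rewrite /xi /centered; ring.
  rewrite vca in rv.
  set D := \sum_(i < k) _.
  have kr0 : 0 < kappa * r by rewrite mulr_gt0.
  (* Weighted AM-GM instead of Cauchy-Schwarz. *)
  have amgm : 2 * \sum_(i < k) t v i * (xi i c - xi i a) <=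
      kappa * r * \sum_(i < k) t v i ^+ 2 + (kappa * r)^-1 * D.
    rewrite /D !mulr_sumr -big_split/=; apply: ler_sum => i _.
    have -> : (xi i a - xi i c) ^+ 2 = (xi i c - xi i a) ^+ 2 by ring.
    set x := t v i; set y := xi i c - xi i a.
    have -> : kappa * r * x ^+ 2 + (kappa * r)^-1 * y ^+ 2 =
       2 * (x * y) + (kappa * r)^-1 * (kappa * r * x - y) ^+ 2.
      by field; rewrite !gt_eqF.
    by rewrite lerDl mulr_ge0 ?sqr_ge0// invr_ge0 ltW.
  (* The weight [kappa * r] is chosen for this bound: one of the two copies of r is absorbed and
     kappa r^2 <= D remains. *)
  have tk : kappa * r * \sum_(i < k) t v i ^+ 2 <= r.
    rewrite mulrAC -[leRHS]mul1r ler_pM2r//.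
    by rewrite mulrC -ler_pdivlMr// mul1r (le_trans tv).
  have : r <= (kappa * r)^-1 * D by lra.
  by rewrite mulrC ler_pdivlMr// mulrCA -expr2.
have [X [Y [mX mY AX CY XY]]] := gauss_measure_separated_hulls sepXi.
have law := orthonormal_law gaussF fe on.
(* Only the preimage of the measurable hull is measured: it contains B up to N. *)
have le_hull (B : set (borel F)) Z : measurable B -> measurable Z ->
    Xi @` (B `\` N) `<=` Z -> (gamma B <= gauss_measure R k Z)%E.
  move=> mB mZ BZ; rewrite -law//.
  have mpre : measurable (Xi @^-1` Z).
    by rewrite -[X in measurable X]setTI; exact: mXi.
  apply: (@le_trans _ _ (gamma (Xi @^-1` Z `|` N))).
    apply: le_measure; rewrite ?inE//; first exact: measurableU.
    move=> w Bw; have [Nw|Nw] := pselect (N w); first by right.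
    by left; apply: BZ; exists w.
  have N0' : (gamma N <= 0)%E by rewrite N0.
  apply: (le_trans (measureU2 _ mpre mN)).
  by rewrite -[leRHS]adde0; apply: leeD.
apply: le_trans XY; apply: lee_pmul => //; exact: le_hull.
Qed.

End separation.

Section gaussian_separation.
Context (R : realType) (F : tvsType R) (gamma : probability (borel F) R).
Hypotheses (gaussF : gaussian_measure gamma) (frechetF : separable_frechet F).
Local Notation kappa := (normal_sqr R).

(** Inner regularity with tolerance half the mass of A. A loss by a factor suits a product bound;
    two such losses give the 4 in [gaussian_separated]. *)
Lemma compact_half (A : set F) : measurable (A : set (borel F)) ->
  (0 < gamma (A : set (borel F)))%E -> exists K : set F,
  [/\ compact K, measurable (K : set (borel F)), K `<=` A &
      (gamma (A : set (borel F)) <= 2%:E * gamma (K : set (borel F)))%E].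
Proof.
move=> mA A0; have [sepF [dist [[d0 deq dC dtri] dnbhs dcomplete]]] := frechetF.
have finA : gamma (A : set (borel F)) \is a fin_num by exact: fin_num_measure.
have e0 : 0 < fine (gamma (A : set (borel F))) / 2.
  by rewrite divr_gt0// fine_gt0// A0 -ge0_fin_numE.
have [K [kK cK KA gK]] :=
  borel_inner_regular gamma deq dC dtri dnbhs sepF dcomplete mA e0.
have mK := borel_closed cK.
exists K; split => //.
have finK : gamma (K : set (borel F)) \is a fin_num by exact: fin_num_measure.
have : (gamma (A : set (borel F)) <=
    gamma (K : set (borel F)) + (fine (gamma (A : set (borel F))) / 2)%:E)%E.
  apply: le_trans (leeD (lexx (gamma (K : set (borel F)))) gK).
  rewrite -measureU//; [|exact: measurableD|by rewrite setDE setIC -setIA setICl setI0].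
  by rewrite setDE setUIr setUv setIT setUidr.
rewrite -(fineK finA) -(fineK finK) -EFinD -EFinM !lee_fin.
by lra.
Qed.

Lemma gaussian_separated r (A C : set F) : 0 < r ->
  measurable (A : set (borel F)) -> measurable (C : set (borel F)) ->
  cm_separated gamma r A C ->
  (gamma (A : set (borel F)) * gamma (C : set (borel F)) <=
    (4 * expR ((1 - kappa * r ^+ 2 / 3) / 4))%:E)%E.
Proof.
move=> r0 mA mC sepAC.
have rhs0 : (0%:E <= (4 * expR ((1 - kappa * r ^+ 2 / 3) / 4))%:E)%E.
  by rewrite lee_fin mulr_ge0// expR_ge0.
have [A0|A0] := eqVneq (gamma (A : set (borel F))) 0%E; first by rewrite A0 mul0e.
have [C0|C0] := eqVneq (gamma (C : set (borel F))) 0%E; first by rewrite C0 mule0.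
have {}A0 : (0 < gamma (A : set (borel F)))%E by rewrite lt_neqAle eq_sym A0/=.
have {}C0 : (0 < gamma (C : set (borel F)))%E by rewrite lt_neqAle eq_sym C0/=.
have [K [kK mK KA AK]] := compact_half mA A0.
have [L [kL mL LC CL]] := compact_half mC C0.
have sepKL : cm_separated gamma r K L by move=> a c /KA Aa /LC Cc; exact: sepAC.
apply: (le_trans (lee_pmul _ _ AK CL)) => //.
rewrite muleACA -EFinM (_ : 2 * 2 = 4); last by ring.
rewrite EFinM lee_pmul2l//.
exact: gaussian_separated_compact.
Qed.

End gaussian_separation.

(** * From integrability and linear growth to Gaussian tails *)

Lemma Lnorm_ae_fin d (T : measurableType d) (R : realType) (P : probability T R)
    (h : T -> \bar R) (r : R) : 0 < r -> measurable_fun setT h ->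
  ('N[P]_(r%:E)[h] < +oo)%E -> {ae P, forall x, h x \is a fin_num}.
Proof.
move=> r0 mh; rewrite unlock => /(lty_poweRy (invr_neq0 (lt0r_neq0 r0))) intfin.
have mpow : measurable_fun setT (fun x => (`|h x| `^ r)%E).
  by apply: (measurableT_comp (measurable_poweR r)); exact: measurableT_comp.
have : P.-integrable setT (fun x => (`|h x| `^ r)%E).
  apply/integrableP; split => //; apply: le_lt_trans intfin.
  by apply: ge0_le_integral => //; [exact: measurableT_comp|move=> x _; rewrite gee0_abs// poweR_ge0].
move=> /(integrable_ae measurableT); apply: filterS => x /(_ I) powfin.
rewrite fin_numE; apply/andP; split; apply: contraTneq powfin => ->;
  by rewrite [(`|_|)%E]/= poweRyr ?gt_eqF.
Qed.

Section tails.
Context (R : realType) (F : tvsType R) (gamma : probability (borel F) R).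

(** These sets exhaust the points where g and s are both finite; were they all null, the whole space
    would be null. Using n + 1 keeps the bound at least 1. *)
Lemma positive_sublevel (g s : borel F -> \bar R) :
  measurable_fun setT g -> measurable_fun setT s ->
  (forall x, 0 <= g x)%E -> (forall x, 0 <= s x)%E ->
  {ae gamma, forall x, g x \is a fin_num} -> {ae gamma, forall x, s x \is a fin_num} ->
  exists n : nat,
    (0 < gamma ([set x | g x <= n.+1%:R%:E] `&` [set x | s x <= n.+1%:R%:E]))%E.
Proof.
move=> mg ms g0 s0 gfin sfin.
pose A (n : nat) : set (borel F) :=
  [set x | (g x <= n.+1%:R%:E)%E] `&` [set x | (s x <= n.+1%:R%:E)%E].
have mA n : measurable (A n).
  apply: measurableI.
    by rewrite -[X in measurable X]setTI; exact: emeasurable_fun_infty_c.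
  by rewrite -[X in measurable X]setTI; exact: emeasurable_fun_infty_c.
apply: contrapT => /forallNP nA.
have A0 n : gamma.-negligible (A n).
  by apply/(negligibleP gamma (mA n))/eqP; rewrite -measure_le0 leNgt; apply/negP; exact: nA.
have : gamma.-negligible (setT : set (borel F)).
  apply: negligibleS (negligibleU (negligible_bigcup A0) (negligibleU gfin sfin)) => x _.
  have [gx|gx] := boolP (g x \is a fin_num); last by right; left => /=; apply/negP.
  have [sx|sx] := boolP (s x \is a fin_num); last by right; right => /=; apply/negP.
  left; exists (Num.bound (Num.max (fine (g x)) (fine (s x)))) => //.
  have M0 : 0 <= Num.max (fine (g x)) (fine (s x)) by rewrite le_max fine_ge0 ?g0.
  have := archi_boundP M0; rewrite gt_max => /andP[h1 h2].
  by split; rewrite /= -1?(fineK gx) -1?(fineK sx) lee_fin -natr1 ltW// ltr_wpDr.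
move/(negligibleP gamma measurableT) => gT0.
have /eqP := etrans (esym (probability_setT gamma)) gT0.
by rewrite onee_eq0.
Qed.

Lemma cm_norm_ge0 h : (0 <= cm_norm gamma h)%E.
Proof.
apply: ereal_sup_ubound; exists \0 => //; split; first exact: cst_continuous.
by change (variance gamma (cst 0%R) <= 1)%E; rewrite variance_cst.
Qed.

Lemma gaussian_tails_of_linear_growth (f : F -> \bar R) (A : set F) (M : R) :
  separable_frechet F -> gaussian_measure gamma ->
  measurable_fun [set: borel F] f -> 1 <= M ->
  measurable (A : set (borel F)) -> (0 < gamma (A : set (borel F)))%E ->
  (forall a h, A a -> cameron_martin gamma h ->
     (f (a + h)%R <= M%:E + M%:E * cm_norm gamma h)%E) ->
  gaussian_tails gamma f.
Proof.
move=> frechetF gaussF mf M1 mA A0 fA.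
have M0 : 0 < M by lra.
pose p := fine (gamma (A : set (borel F))).
have pE : gamma (A : set (borel F)) = p%:E by rewrite fineK// fin_num_measure.
have p0 : 0 < p by rewrite -lte_fin -pE.
have k0 : 0 < normal_sqr R := normal_sqr_gt0 R.
(* The separation bound has exponent -kappa r^2 / 12, and r >= rho / (2 M) for rho > 2 M; hence 48 =
   12 * 4. *)
pose eta := normal_sqr R / (48 * M ^+ 2).
(* The first term covers rho <= 2 M, where eta rho^2 <= kappa / 12 and the trivial bound 1 suffices.
   The second is the constant of the separation bound divided by the mass p of A. *)
exists (expR (normal_sqr R / 12) + 4 * expR (1 / 4) / p), eta; split.
- by rewrite addr_gt0 ?expR_gt0// divr_gt0// mulr_gt0// expR_gt0.
- by rewrite divr_gt0// mulr_gt0// exprn_gt0//; lra.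
move=> rho rho0.
set C : set (borel F) := [set x | _].
have mC : measurable C.
  by rewrite -[X in measurable X]setTI; exact: emeasurable_fun_o_infty.
have e0 := expR_gt0 (- eta * rho ^+ 2).
have M2 : 0 < M ^+ 2 by rewrite exprn_gt0//; lra.
have [rhoM|Mrho] := leP rho (2 * M).
  apply: (le_trans (probability_le1 gamma mC)); rewrite lee_fin mulrDl.
  apply: (@le_trans _ _ (expR (normal_sqr R / 12) * expR (- eta * rho ^+ 2))).
    rewrite -expRD -[leLHS]expR0 ler_expR mulNr subr_ge0.
    rewrite /eta -mulrA ler_pM2l// mulrC ler_pdivrMr ?mulr_gt0//.
    rewrite mulrA (_ : 12^-1 * 48 = 4); last by field.
    have : rho ^+ 2 <= (2 * M) ^+ 2 by rewrite lerXn2r ?nnegrE//; lra.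
    by rewrite exprMn; lra.
  by rewrite lerDl mulr_ge0 ?(ltW e0)// divr_ge0 ?(ltW p0)// mulr_ge0// expR_ge0.
(* The solution of M + M r = rho. *)
pose r := (rho - M) / M.
have r0 : 0 < r by rewrite divr_gt0//; lra.
have sep : cm_separated gamma r (A : set (borel F)) C.
  move=> a c Aa fc.
  suff : (r%:E < cm_norm gamma (c - a)%R)%E.
    by move=> /ereal_sup_gt[_ [l [cl vl] <-]]; rewrite lte_fin => rl; exists l.
  (* The growth condition applies to Cameron-Martin vectors; otherwise the norm is infinite and
     exceeds r at once. *)
  have [hfin|hinf] := pselect (cameron_martin gamma (c - a)); last first.
    move/negP: hinf; rewrite -leNgt leye_eq => /eqP ->; exact: ltry.
  have := fA a (c - a) Aa hfin; rewrite subrKC => fca.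
  rewrite ltNge; apply/negP => hr.
  have : (rho%:E < M%:E + M%:E * r%:E)%E.
    apply: lt_le_trans fc (le_trans fca _).
    by rewrite leeD2l// lee_pmul2l.
  rewrite -EFinM -EFinD lte_fin /r mulrC divfK ?gt_eqF//; lra.
have := gaussian_separated gaussF frechetF r0 mA mC sep.
have finC : gamma C \is a fin_num by exact: fin_num_measure.
rewrite pE -(fineK finC) -EFinM !lee_fin mulrC -ler_pdivlMr// => /le_trans; apply.
rewrite [leRHS]mulrDl; apply: (@le_trans _ _ (4 * expR (1 / 4) / p * expR (- eta * rho ^+ 2))).
  rewrite [leRHS]mulrAC ler_pM2r ?invr_gt0// -[leRHS]mulrA ler_pM2l// -expRD ler_expR.
  have rr : rho / (2 * M) <= r.
    have q : 2 < rho / M by rewrite ltr_pdivlMr.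
    rewrite (_ : rho / (2 * M) = rho / M / 2); last by field; rewrite gt_eqF.
    rewrite (_ : r = rho / M - 1); last by rewrite /r; field; rewrite gt_eqF.
    by move: (rho / M) q => u; lra.
  have r2 : (rho / (2 * M)) ^+ 2 <= r ^+ 2.
    by rewrite lerXn2r ?nnegrE ?(ltW r0)// divr_ge0// mulr_ge0// ltW.
  have -> : - eta * rho ^+ 2 = - (normal_sqr R * (rho / (2 * M)) ^+ 2 / 12).
    by rewrite /eta; field; rewrite gt_eqF.
  have := ler_wpM2l (ltW k0) r2.
  by move: (_ * (rho / (2 * M)) ^+ 2) (_ * r ^+ 2) => u v; lra.
by rewrite lerDr mulr_ge0// expR_ge0.
Qed.

End tails.

Local Open Scope ereal_scope.

Theorem corollary3p2 (R : realType) (F : tvsType R)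
    (gamma : probability (borel F) R) (f : F -> \bar R)
    (g sigma : {RV gamma >-> \bar R}) :
  separable_frechet F ->
  gaussian_measure gamma ->
  measurable_fun [set: borel F] f -> (forall x, 0 <= f x) ->
  (forall x, 0 <= g x) -> 'N[gamma]_1[g] < +oo ->
  (forall x, 0 <= sigma x) -> 'N[gamma]_2%:E[sigma] < +oo ->
  (forall (x h : F), h \in cameron_martin gamma ->
     f (x + h)%R <= g x + sigma x * cm_norm gamma h) ->
  gaussian_tails gamma f.
Proof.
move=> frechetF gaussF mf f0 g0 g1 sg0 sg2 fgs.
have mg : measurable_fun setT (g : borel F -> \bar R) by [].
have ms : measurable_fun setT (sigma : borel F -> \bar R) by [].
have gfin : {ae gamma, forall x, g x \is a fin_num} by exact: Lnorm_ae_fin g1.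
have sfin : {ae gamma, forall x, sigma x \is a fin_num} by exact: Lnorm_ae_fin sg2.
have [n An0] := positive_sublevel mg ms g0 sg0 gfin sfin.
apply: (@gaussian_tails_of_linear_growth _ _ _ _ _ n.+1%:R) An0 _ => //.
  by rewrite ler1n.
  apply: measurableI.
    by rewrite -[X in measurable X]setTI; exact: emeasurable_fun_infty_c.
  by rewrite -[X in measurable X]setTI; exact: emeasurable_fun_infty_c.
move=> a h [/= ga sa] cmh; apply: (le_trans (fgs a h _)); first by rewrite inE.
by apply: leeD => //; apply: lee_pmul => //; exact: cm_norm_ge0.
Qed.
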